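(* Let $\mathcal B$ be a unital C*-algebra, let $\mathcal X\subseteq\mathcal B$ be a linear subspace (regarded as an operator space with the matrix norms inherited from $\mathcal B$), and let $\mathcal H$ be a Hilbert space. (1) If $\psi:\mathcal X\to\mathcal H_r=B(\mathcal H,\mathbb C)$ is a completely contractive linear map, then there exist a state $s:\mathcal B\to\mathbb C$ and a unital completely positive map $\Phi:\mathcal B\to B(\mathcal H)$ such that for every $x\in\mathcal X$, $$\|\psi(x)\|^2\le s(xx^* )\quad\text{and}\quad \psi(x)^*\psi(x)\le\Phi(x^*x).$$ (2) If $\psi:\mathcal X\to\mathcal H_c=B(\mathbb C,\mathcal H)$ is a completely contractive linear map, then there exist a state $s:\mathcal B\to\mathbb C$ and a unital completely positive map $\Phi:\mathcal B\to B(\mathcal H)$ such that for every $x\in\mathcal X$, $$\|\psi(x)\|^2\le s(x^*x)\quad\text{and}\quad \psi(x)\psi(x)^*\le\Phi(xx^* ).$$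
   Context: For a complex Hilbert space $\mathcal H$, the row Hilbert space is the operator space $\mathcal H_r=B(\mathcal H,\mathbb C)$ and the column Hilbert space is the operator space $\mathcal H_c=B(\mathbb C,\mathcal H)$, with their natural operator space structures as spaces of bounded operators between Hilbert spaces, i.e. $M_{m,n}(B(\mathcal H,\mathbb C))=B(\mathcal H^{(n)},\mathbb C^m)$ and $M_{m,n}(B(\mathbb C,\mathcal H))=B(\mathbb C^n,\mathcal H^{(m)})$. If $v\in\mathcal H_r$ then $v^*v\in B(\mathcal H)$, and if $v\in\mathcal H_c$ then $vv^*\in B(\mathcal H)$; these are positive operators of rank at most one. *)

(* Defs.v *)
From HB Require Import structures.
From mathcomp Require Import all_boot all_order all_algebra.
From mathcomp Require Import sesquilinear complex.
From mathcomp Require Import all_classical all_reals all_analysis.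
Set Implicit Arguments.
Unset Strict Implicit.
Unset Printing Implicit Defensive.

Import Order.TTheory GRing.Theory Num.Theory.
Import numFieldNormedType.Exports.

Local Open Scope classical_set_scope.
Local Open Scope ring_scope.
Local Open Scope complex_scope.

(* In R[i], [0 <= z] means that z is real and nonnegative, and norms of
   R[i]-normed modules take their values in R[i]. *)

Section BoundedOperators.
Variables (K : numFieldType) (V W : normedModType K).

Definition bounded_linear : {pred V -> W} :=
  fun f => `[< linear f /\ exists M : K, forall v, `|f v| <= M * `|v| >].

Lemma bounded_linear_submod : submod_closed bounded_linear.
Proof.
split.
  apply/asboolP; split.
    by move=> a u v; rewrite (_ : (0 : V -> W) = fun=> 0)// scaler0 addr0.
  by exists 0 => v; rewrite mul0r (_ : (0 : V -> W) = fun=> 0)// normr0.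
move=> a f g /asboolP[fl [M fM]] /asboolP[gl [N gN]].
have E v : (a *: f + g) v = a *: f v + g v by [].
apply/asboolP; split.
  move=> b u v; rewrite !E fl gl !scalerDr !scalerA (mulrC a b).
  by rewrite addrACA.
exists (`|a| * M + N) => v; rewrite E mulrDl (le_trans (ler_normD _ _))//.
by rewrite lerD// normrZ -mulrA ler_wpM2l.
Qed.

HB.instance Definition _ :=
  GRing.isSubmodClosed.Build K (V -> W) bounded_linear bounded_linear_submod.

Record bop := Bop { bop_fun :> V -> W ; bop_funP : bop_fun \in bounded_linear }.

HB.instance Definition _ := [isSub for bop_fun].
HB.instance Definition _ := [Choice of bop by <:].
HB.instance Definition _ := [SubChoice_isSubLmodule of bop by <:].

End BoundedOperators.

Section Composition.
Variable K : numFieldType.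

Lemma bounded_linear_id (V : normedModType K) :
  (id : V -> V) \in @bounded_linear K V V.
Proof. by apply/asboolP; split=> //; exists 1 => v; rewrite mul1r. Qed.

Definition bop_id (V : normedModType K) : bop V V := Bop (bounded_linear_id V).

Lemma bounded_linear_comp (U V W : normedModType K) (S : bop V W)
  (T : bop U V) : (S \o T) \in @bounded_linear K U W.
Proof.
have /asboolP[Sl [M SM]] := bop_funP S; have /asboolP[Tl [N TN]] := bop_funP T.
apply/asboolP; split; first by move=> a u v; rewrite /= Tl Sl.
exists (`|M| * N) => v; rewrite /= -mulrA (le_trans (SM _))//.
have [->|Tv0] := eqVneq (T v) 0.
  by rewrite normr0 mulr0 mulr_ge0// (le_trans _ (TN v)).
have M0 : 0 <= M.
  by rewrite -(pmulr_lge0 M (_ : 0 < `|T v|)) ?normr_gt0// (le_trans _ (SM _)).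
by rewrite ger0_norm// ler_wpM2l.
Qed.

Definition bop_comp (U V W : normedModType K) (S : bop V W) (T : bop U V) :
  bop U W := Bop (bounded_linear_comp S T).

End Composition.

HB.mixin Record NormedModule_isPreHilbert (R : realType) H
    & NormedModule R[i] H := {
  hdot : {dot H for @Num.conj R[i]} ;
  hdot_norm : forall u : H, hdot u u = `|u| ^+ 2 }.

#[short(type="preHilbertType")]
HB.structure Definition PreHilbert (R : realType) :=
  { H of NormedModule R[i] H & NormedModule_isPreHilbert R H }.

#[short(type="hilbertType")]
HB.structure Definition Hilbert (R : realType) :=
  { H of PreHilbert R H & CompleteNormedModule R[i] H }.

Section ComplexLine.
Variable R : realType.

Definition cdot (u v : R[i]^o) : R[i] := u * (v^*)%R.

Let cdotl_lin v : GRing.linear_for *%R (cdot^~ v).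
Proof. by move=> a u w; rewrite /cdot mulrDl -mulrA. Qed.

Let cdotr_lin u : GRing.linear_for (@Num.conj R[i] \; *%R) (cdot u).
Proof. by move=> a v w; rewrite /cdot /= rmorphD rmorphM mulrDr mulrCA. Qed.

HB.instance Definition _ :=
  bilinear_isBilinear.Build R[i] R[i]^o R[i]^o R[i] *%R
    (@Num.conj R[i] \; *%R) cdot (cdotl_lin, cdotr_lin).

Let cdot_herm u v : cdot u v = (-1) ^+ false * ((cdot v u)^*)%R.
Proof. by rewrite /cdot expr0 mul1r rmorphM /= conjCK mulrC. Qed.

HB.instance Definition _ :=
  isHermitianSesquilinear.Build R[i] R[i]^o false (@Num.conj R[i]) cdot
    cdot_herm.

Let cdot_gt0 (u : R[i]^o) : u != 0 -> 0 < cdot u u.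
Proof. by move=> u0; rewrite /cdot mul_conjC_gt0. Qed.

HB.instance Definition _ :=
  isDotProduct.Build R[i] R[i]^o cdot cdot_gt0.

Let cdot_norm (u : R[i]^o) : cdot u u = `|u| ^+ 2.
Proof. by rewrite normCK. Qed.

HB.instance Definition _ :=
  NormedModule_isPreHilbert.Build R R[i]^o cdot_norm.

End ComplexLine.

Section Operators.
Variable R : realType.
Local Notation C := R[i].

Definition opnorm (V W : normedModType C) (T : bop V W) : R :=
  inf [set t : R | 0 <= t /\ forall v, `|T v| <= t%:C * `|v|].

Definition is_adjoint (H K : preHilbertType R) (T : bop H K) (S : bop K H) :=
  forall h k, hdot (T h) k = hdot h (S k).

(* The default value 0 is never used when H is complete: T then has exactly one
   adjoint, by the Riesz representation theorem. *)
Definition adj (H K : preHilbertType R) (T : bop H K) : bop K H :=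
  xget 0 [set S | is_adjoint T S].

Definition op_pos (H : preHilbertType R) (T : bop H H) :=
  forall h, 0 <= hdot (T h) h.

Definition op_le (H : preHilbertType R) (S T : bop H H) := op_pos (T - S).

(* A matrix over B(H, K) acting as an operator from the Hilbert space direct sum
   H^(n), whose vectors are the families ['I_n -> H], to K^(m). *)
Definition mxop_apply (H K : preHilbertType R) m n (T : 'M[bop H K]_(m, n))
    (h : 'I_n -> H) : 'I_m -> K :=
  fun i => \sum_j T i j (h j).

Definition dsum_norm (H : preHilbertType R) n (h : 'I_n -> H) : C :=
  sqrtC (\sum_i `|h i| ^+ 2).

Definition dsum_dot (H : preHilbertType R) n (h k : 'I_n -> H) : C :=
  \sum_i hdot (h i) (k i).

Definition mxopnorm (H K : preHilbertType R) m n (T : 'M[bop H K]_(m, n)) : R :=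
  inf [set t : R | 0 <= t /\
    forall h, dsum_norm (mxop_apply T h) <= t%:C * dsum_norm h].

Definition mxop_pos (H : preHilbertType R) n (T : 'M[bop H H]_n) :=
  forall h, 0 <= dsum_dot (mxop_apply T h) h.

End Operators.

(* The norm is a field here, instead of coming from completeNormedModType R[i],
   because Hierarchy Builder admits no join of that structure with rings. *)
HB.mixin Record Algebra_isCstar (R : realType) B & GRing.Algebra R[i] B := {
  star : B -> B ;
  cnorm : B -> R ;
  starK : involutive star ;
  starD : {morph star : a b / a + b} ;
  starZ : forall (c : R[i]) (a : B), star (c *: a) = (c^*)%R *: star a ;
  starM : forall a b : B, star (a * b) = star b * star a ;
  cnorm_eq0 : forall a : B, cnorm a = 0 -> a = 0 ;
  ler_cnormD : forall a b : B, cnorm (a + b) <= cnorm a + cnorm b ;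
  cnormZ : forall (c : R[i]) (a : B),
    (cnorm (c *: a))%:C = `|c| * (cnorm a)%:C ;
  ler_cnormM : forall a b : B, cnorm (a * b) <= cnorm a * cnorm b ;
  cnorm_star : forall a : B, cnorm (star a * a) = cnorm a ^+ 2 ;
  cnorm_complete : forall u : nat -> B,
    (forall e : R, 0 < e -> exists N, forall m n,
       (N <= m)%N -> (N <= n)%N -> cnorm (u m - u n) < e) ->
    exists l : B, cnorm (u n - l) @[n --> \oo] --> (0 : R) }.

#[short(type="cstarType")]
HB.structure Definition Cstar (R : realType) :=
  { B of GRing.Algebra R[i] B & Algebra_isCstar R B }.

Section CstarAlgebras.
Variables (R : realType) (B : cstarType R).
Local Notation C := R[i].

Definition mxstar m n (A : 'M[B]_(m, n)) : 'M[B]_(n, m) := (map_mx star A)^T.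

Definition is_representation (K : hilbertType R) (pi : {linear B -> bop K K}) :=
  [/\ pi 1 = bop_id K,
      forall a b, pi (a * b) = bop_comp (pi a) (pi b)
    & forall a, is_adjoint (pi a) (pi (star a))].

(* By the Gelfand-Naimark theorem the supremum is attained at any faithful
   representation, and it is the unique norm that makes the *-algebra M_n(B) a
   C*-algebra. *)
Definition cstar_mxnorm n (A : 'M[B]_n) : R :=
  sup [set r : R | exists (K : hilbertType R) (pi : {linear B -> bop K K}),
    is_representation pi /\ r = mxopnorm (map_mx pi A)].

Definition completely_contractive (P : pred B) (X : @subLmodType C B P)
    (H K : preHilbertType R) (psi : X -> bop H K) :=
  forall n (x : 'M[X]_n),
    mxopnorm (map_mx psi x) <= cstar_mxnorm (map_mx val x).

Definition is_state (s : {scalar B}) :=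
  (forall b, 0 <= s (star b * b)) /\ s 1 = 1.

(* The positive elements of the C*-algebra M_n(B) are those of the form
   D^* *m D. *)
Definition completely_positive (H : preHilbertType R)
    (Phi : {linear B -> bop H H}) :=
  forall n (D : 'M[B]_n), mxop_pos (map_mx Phi (mxstar D *m D)).

Definition is_ucp (H : preHilbertType R) (Phi : {linear B -> bop H H}) :=
  completely_positive Phi /\ Phi 1 = bop_id H.

End CstarAlgebras.

(* Main.v *)
Require Import Defs.
From HB Require Import structures.
From mathcomp Require Import all_boot all_order all_algebra.
From mathcomp Require Import sesquilinear complex.
From mathcomp Require Import all_classical all_reals all_analysis.
From mathcomp Require Import ring lra.
Set Implicit Arguments.
Unset Strict Implicit.
Unset Printing Implicit Defensive.

Import Order.TTheory GRing.Theory Num.Theory.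
Import numFieldNormedType.Exports.

Local Open Scope classical_set_scope.
Local Open Scope ring_scope.
Local Open Scope complex_scope.

(** Both parts of the theorem are instances of one statement. Let j : Z -> B and
xi : Z -> H be linear. In the column case Z = X, j x = x and xi x = psi x 1; in
the row case Z is the conjugate space of X, j x = star x and xi x is the vector
such that psi x h = <h, xi x>. The claim is then that a state s and a unital
completely positive map Phi satisfy

  |xi z|^2 <= s (star (j z) * j z)   and
  |<xi z, h>|^2 <= <Phi (j z * star (j z)) h, h>.

The state. Complete contractivity, applied to matrices with a single nonzero
column or a single nonzero row, says that sum |xi z_i|^2 <= r as soon as
r - sum star (j z_i) * j z_i is positive ([column_vector_contractive],
[row_vector_contractive]): a positive element is a square k * k, so that
inequality bounds the operator norm in each representation of B. Consequently the
convex cone generated by the positive elements and by the elements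
star (j z) * j z - |xi z|^2 does not contain -1. A proper cone with an order unit
lies in the half space of a functional ([cone_separation]), and this functional is
the state ([dominating_state]). The argument rests on the fact that star a * a is
positive in a C*-algebra ([cpos_star_mul]); it is derived here from the norm
axioms, positivity of a self-adjoint h meaning |t - h| <= t for some t.

The completely positive map. In the GNS representation pi of s, with cyclic
vector W, the first inequality says that pi (j z) W |-> xi z extends to a
contraction T into H, vanishing on the orthogonal complement. The map
b |-> T pi(b) T' is completely positive, where T' is the adjoint of T, and

  |<xi z, h>|^2 = |<W, pi (star (j z)) T' h>|^2 <= <T pi (j z * star (j z)) T' h, h>.

Adding s(b) (1 - T T') makes it unital, and Schur's product theorem
([schur_product]) shows that the added term is completely positive. No completion
of the GNS space is formed: T' h is a limit of vectors pi (j u) W with u in Z,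
found by almost minimising a quadratic functional ([approx_riesz]), and the
sesquilinear form of T pi(b) T' is the limit of s (star (j v) * b * j u)
([compression]). A bounded form on H then comes from an operator
([bop_of_form]). *)

(** * Identities in abelian groups *)

(** Reflected group expressions. The ring tactics need commutative products, while
identities between noncommutative expressions become linear, hence decidable on
coefficients, once the products are expanded. *)
Inductive zexpr := ZZero | ZAtom of nat | ZAdd of zexpr & zexpr | ZOpp of zexpr.

Fixpoint zeval (V : zmodType) (env : seq V) (e : zexpr) : V :=
  match e with
  | ZZero => 0
  | ZAtom i => nth 0 env i
  | ZAdd e1 e2 => zeval env e1 + zeval env e2
  | ZOpp e1 => - zeval env e1
  end.

Fixpoint zcoef (e : zexpr) (i : nat) : int :=
  match e with
  | ZZero => 0
  | ZAtom j => ((i == j)%N : nat)%:Z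
  | ZAdd e1 e2 => zcoef e1 i + zcoef e2 i
  | ZOpp e1 => - zcoef e1 i
  end.

Lemma zeval_coef (V : zmodType) (env : seq V) e :
  zeval env e = \sum_(i < size env) nth 0 env i *~ zcoef e i.
Proof.
elim: e => [|j|e1 h1 e2 h2|e1 h1] /=.
- by rewrite big1.
- have [js|js] := ltnP j (size env); last first.
    rewrite nth_default// big1// => i _.
    by rewrite (ltn_eqF (leq_trans (ltn_ord i) js)).
  rewrite (bigD1 (Ordinal js))//= eqxx big1 ?addr0// => i ij.
  rewrite (_ : (i == j :> nat) = false)//.
  by apply: contraNF ij => /eqP e; apply/eqP/val_inj.
- by rewrite h1 h2 -big_split; apply: eq_bigr => i _; rewrite mulrzDr.
- by rewrite h1 -sumrN; apply: eq_bigr => i _; rewrite mulrNz.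
Qed.

Lemma zexpr_eq (V : zmodType) (env : seq V) e1 e2 :
  all (fun i => zcoef e1 i == zcoef e2 i) (iota 0 (size env)) ->
  zeval env e1 = zeval env e2.
Proof.
move=> /allP h; rewrite !zeval_coef; apply: eq_bigr => i _.
by rewrite (eqP (h i _)) // mem_iota ltn_ord.
Qed.

(* Atoms are compared up to conversion, since equal products may carry different
   but convertible structure instances. *)
Ltac zsame a b :=
  match constr:(tt) with
  | _ => let _ := constr:(erefl a : a = b) in constr:(true)
  | _ => constr:(false)
  end.
Ltac zindex env t :=
  match env with
  | ?a :: ?env' =>
      match zsame a t with
      | true => constr:(Some 0%N)
      | false => match zindex env' t with
                 | Some ?n => constr:(Some n.+1)
                 | None => constr:(@None nat)
                 end
      end
  | _ => constr:(@None nat)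
  end.
Ltac zatoms env t :=
  match t with
  | (?a + ?b)%R => let env' := zatoms env a in zatoms env' b
  | (- ?a)%R => zatoms env a
  | (0)%R => env
  | _ => match zindex env t with
         | Some _ => env
         | None => constr:(t :: env)
         end
  end.
Ltac zreify env t :=
  match t with
  | (?a + ?b)%R => let a' := zreify env a in let b' := zreify env b in
                   constr:(ZAdd a' b')
  | (- ?a)%R => let a' := zreify env a in constr:(ZOpp a')
  | (0)%R => constr:(ZZero)
  | _ => match zindex env t with Some ?n => constr:(ZAtom n) end
  end.
(** Decides identities that hold in every abelian group. *)
Ltac zmodule :=
  match goal with
  | |- @eq ?T ?l ?r =>
    let env := zatoms (@nil T) l in
    let env := zatoms env r in
    let l' := zreify env l in
    let r' := zreify env r in
    apply: (@zexpr_eq _ env l' r'); vm_compute; reflexivity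
  end.

(** * Square roots in C*-algebras *)

Section StarNorm.
Variables (R : realType) (B : cstarType R).
Implicit Types a b c x y : B.

Lemma star_is_zmod_morphism : zmod_morphism (@star R B).
Proof.
have s0 : star 0 = 0 :> B by apply: (addrI (star 0)); rewrite -starD !addr0.
by move=> a b; apply/eqP; rewrite -subr_eq opprK -starD subrK.
Qed.

HB.instance Definition _ :=
  GRing.isZmodMorphism.Build B B (@star R B) star_is_zmod_morphism.

Lemma star1 : star 1 = 1 :> B.
Proof. by rewrite -[LHS]mulr1 -[X in _ * X](starK 1) -starM mulr1 starK. Qed.

Lemma starZr (r : R) a : star (r%:C *: a) = r%:C *: star a.
Proof. by rewrite starZ conj_Creal // complex_real. Qed.

Lemma cnormZr (r : R) a : cnorm (r%:C *: a) = `|r| * cnorm a.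
Proof.
apply: (@complexI R); rewrite cnormZ rmorphM /=; congr (_ * _).
by rewrite normc_def /= expr0n addr0 sqrtr_sqr.
Qed.

Lemma cnorm0 : cnorm (0 : B) = 0.
Proof. by rewrite -(scale0r 0) -[0]/((0 : R)%:C) cnormZr normr0 mul0r. Qed.

Lemma cnormN a : cnorm (- a) = cnorm a.
Proof.
by rewrite -scaleN1r -[-1](rmorphN1 (real_complex R)) cnormZr normrN1 mul1r.
Qed.

Lemma ler_cnormB a b : cnorm (a - b) <= cnorm a + cnorm b.
Proof. by rewrite -(cnormN b) ler_cnormD. Qed.

Lemma cnormBC a b : cnorm (a - b) = cnorm (b - a).
Proof. by rewrite -cnormN opprB. Qed.

Lemma cnorm_ge0 a : 0 <= cnorm a.
Proof.
have := ler_cnormB a a; rewrite subrr cnorm0 -mulr2n.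
by rewrite pmulrn_lge0.
Qed.

Lemma cnorm_le0 a : cnorm a <= 0 -> a = 0.
Proof. by move=> h; apply: cnorm_eq0; apply/eqP; rewrite eq_le h cnorm_ge0. Qed.

Lemma cnorm_star_le a : cnorm a <= cnorm (star a).
Proof.
have [a0|a0] := leP (cnorm a) 0; first exact: le_trans (cnorm_ge0 _).
by rewrite -(ler_pM2r a0) -expr2 -cnorm_star ler_cnormM.
Qed.

Lemma cnorm_starE a : cnorm (star a) = cnorm a.
Proof.
apply/eqP; rewrite eq_le cnorm_star_le andbT.
by rewrite -{2}(starK a) cnorm_star_le.
Qed.

Lemma cnorm_sqr_sa a : star a = a -> cnorm (a * a) = cnorm a ^+ 2.
Proof. by move=> sa; rewrite -{1}sa cnorm_star. Qed.

Lemma cnorm1 : cnorm (1 : B) = 1.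
Proof.
have := cnorm_sqr_sa star1; rewrite mulr1 => e.
have n0 : cnorm (1 : B) != 0.
  by apply/eqP => /cnorm_eq0/eqP; rewrite oner_eq0.
by apply: (mulfI n0); rewrite mulr1 -expr2 -e.
Qed.

Lemma cnorm_scale1 (r : R) : cnorm (r%:C%:A : B) = `|r|.
Proof. by rewrite cnormZr cnorm1 mulr1. Qed.

Lemma cnorm_real1 (r : R) : 0 <= r -> cnorm (r%:C%:A : B) = r.
Proof. by move=> r0; rewrite cnorm_scale1 ger0_norm. Qed.

(** Equalities between limits are proved by bounding the norm of a difference by
arbitrarily small multiples of one constant. *)
Lemma cnorm_small a (M : R) : (forall e : R, 0 < e -> cnorm a <= M * e) -> a = 0.
Proof.
move=> h; apply: cnorm_le0; apply/ler_addgt0Pr => e e0; rewrite add0r.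
have M0 : 0 < `|M| + 1 by rewrite ltr_wpDl.
apply: le_trans (h (e / (`|M| + 1)) _) _; first exact: divr_gt0.
rewrite mulrA ler_pdivrMr// mulrC ler_wpM2l ?(ltW e0)//.
by rewrite (le_trans (ler_norm _)) // lerDl.
Qed.

(** The square root of 1 - c, for c self-adjoint in the closed unit ball, is
1 - y where y is a fixed point of y = (c + y * y) / 2. *)
Definition sqrt_step c y : B := (2^-1 : R)%:C *: (c + y * y).
Definition sqrt_iter c n : B := iter n (sqrt_step c) 0.
(** The scalar case c = 1 of the iteration, whose increments dominate those of every
other case. *)
Definition sqrt_maj n : R := iter n (fun t : R => 2^-1 * (1 + t * t)) 0.

Lemma sqrt_maj_itv n : 0 <= sqrt_maj n <= 1.
Proof.
elim: n => [|n /andP[h0 h1]]; first by rewrite lexx ler01.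
rewrite /= -/(sqrt_maj n); apply/andP; split; nra.
Qed.

Lemma sqrt_maj_le m n : (n <= m)%N -> sqrt_maj n <= sqrt_maj m.
Proof.
move=> nm; apply: (@homo_leq _ _ <=%R) nm => // [|k]; first exact: le_trans.
rewrite /= -/(sqrt_maj k).
by have /andP[] := sqrt_maj_itv k => *; nra.
Qed.

Lemma sqrt_maj_cauchy (e : R) : 0 < e ->
  exists N, forall m n, (N <= n)%N -> (n <= m)%N -> sqrt_maj m - sqrt_maj n < e.
Proof.
move=> e0; pose A := range sqrt_maj.
have hs : has_sup A.
  split; first by exists (sqrt_maj 0), 0.
  by exists 1 => _ [n _ <-]; have /andP[] := sqrt_maj_itv n.
have [_ [N _ <-] hN] := sup_adherent e0 hs.
exists N => m n Nn nm; have h1 := sqrt_maj_le Nn.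
have h2 : sqrt_maj m <= sup A by apply: ub_le_sup; [case: hs | exists m].
lra.
Qed.

(** Since y * y - z * z = y * (y - z) + (y - z) * z, the increments of the iteration
are bounded by those of the scalar iteration with c = 1, without any strict
contraction. This reaches the boundary case of norm one. *)
Lemma sqrt_iter_le c : cnorm c <= 1 -> forall n m, (n <= m)%N ->
  cnorm (sqrt_iter c m - sqrt_iter c n) <= sqrt_maj m - sqrt_maj n.
Proof.
move=> c1.
have hn m : cnorm (sqrt_iter c m) <= sqrt_maj m.
  elim: m => [|m ih]; first by rewrite cnorm0.
  rewrite /= -/(sqrt_iter c m) -/(sqrt_maj m) cnormZr ger0_norm ?invr_ge0//.
  rewrite ler_pM2l ?invr_gt0// (le_trans (ler_cnormD _ _))// lerD//.
  by rewrite (le_trans (ler_cnormM _ _))// ler_pM ?cnorm_ge0.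
elim=> [|n ih] [|m]// nm; rewrite ?subr0 ?subrr ?cnorm0//.
rewrite /= -/(sqrt_iter c m) -/(sqrt_iter c n) -/(sqrt_maj m) -/(sqrt_maj n).
have {ih} := ih m nm; set y := sqrt_iter c m; set z := sqrt_iter c n => h.
rewrite -scalerBr cnormZr ger0_norm ?invr_ge0// -mulrBr.
rewrite ler_pM2l ?invr_gt0// !opprD !addrA [c + _]addrC addrK.
rewrite [1 + _]addrC addrK.
have -> : y * y - z * z = y * (y - z) + (y - z) * z.
  by rewrite mulrBr mulrBl addrA subrK.
apply: le_trans (ler_cnormD _ _) _.
have -> : sqrt_maj m * sqrt_maj m - sqrt_maj n * sqrt_maj n =
  sqrt_maj m * (sqrt_maj m - sqrt_maj n) + (sqrt_maj m - sqrt_maj n) * sqrt_maj n.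
  by ring.
by rewrite lerD// (le_trans (ler_cnormM _ _))// ler_pM ?cnorm_ge0// hn.
Qed.

Lemma sqrt_iter_cvg c : cnorm c <= 1 ->
  exists l, forall e : R, 0 < e ->
    exists N, forall n, (N <= n)%N -> cnorm (sqrt_iter c n - l) < e.
Proof.
move=> c1; have [|l hl] := @cnorm_complete R B (sqrt_iter c).
  move=> e e0; have [N hN] := sqrt_maj_cauchy e0; exists N => m n Nm Nn.
  wlog nm : m n Nm Nn / (n <= m)%N => [H|].
    by have [/H->//|/ltnW/H h] := leqP n m; rewrite cnormBC h.
  exact: le_lt_trans (sqrt_iter_le c1 nm) (hN _ _ Nn nm).
exists l => e e0; move/cvgrPdist_lt: hl => /(_ e e0)[N _ hN].
exists N => n Nn; have := hN n Nn; rewrite /= sub0r normrN.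
exact: le_lt_trans (ler_norm _).
Qed.

Lemma sqrt_one_sub c : star c = c -> cnorm c <= 1 ->
  exists y, [/\ star y = y, cnorm y <= 1, (1 - y) * (1 - y) = 1 - c
    & forall x, x * c = c * x -> x * y = y * x].
Proof.
move=> sc c1; have [y hy] := sqrt_iter_cvg c1.
have y1 : cnorm y <= 1.
  apply/ler_addgt0Pr => e e0; have [N /(_ N (leqnn _)) hN] := hy e e0.
  have -> : y = sqrt_iter c N - (sqrt_iter c N - y) by rewrite opprB addrC subrK.
  rewrite (le_trans (ler_cnormB _ _))// lerD ?(ltW hN)//.
  have := sqrt_iter_le c1 (leq0n N); rewrite !subr0 => /le_trans; apply.
  by have /andP[] := sqrt_maj_itv N.
have in1 n : cnorm (sqrt_iter c n) <= 1.
  have := sqrt_iter_le c1 (leq0n n); rewrite !subr0 => /le_trans; apply.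
  by have /andP[] := sqrt_maj_itv n.
exists y; split=> //.
- apply/eqP; rewrite -subr_eq0; apply/eqP.
  apply: (@cnorm_small _ 2) => e e0; have [N /(_ N (leqnn _)) hN] := hy e e0.
  have sN : star (sqrt_iter c N) = sqrt_iter c N.
    by elim: N {hN} => [|n ih]; rewrite ?raddf0//= starZr raddfD/= starM ih sc.
  have -> : star y - y = (sqrt_iter c N - y) - star (sqrt_iter c N - y).
    by rewrite raddfB/= sN opprB [RHS]addrC addrA subrK.
  rewrite (le_trans (ler_cnormB _ _))// cnorm_starE; lra.
- have E : y + y = c + y * y.
    apply/eqP; rewrite -subr_eq0; apply/eqP.
    apply: (@cnorm_small _ 4) => e e0; have [N hN] := hy e e0.
    have h1 := hN N (leqnn _); have h2 := hN N.+1 (leqnSn _).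
    set z := sqrt_iter c N in h1; set w := sqrt_iter c N.+1 in h2.
    have ew : w + w = c + z * z.
      rewrite /w /= -/(sqrt_iter c N) -/z /sqrt_step -scalerDl -rmorphD /=.
      by rewrite (_ : 2^-1 + 2^-1 = 1 :> R) ?scale1r//; lra.
    have -> : y + y - (c + y * y) = z * (z - y) + (z - y) * y - (w - y) - (w - y).
      transitivity (y + y - (c + y * y) + (c + z * z - (w + w))).
        by rewrite ew subrr addr0.
      rewrite mulrBr mulrBl; zmodule.
    rewrite (le_trans (ler_cnormB _ _))//.
    have t1 := ler_cnormB (z * (z - y) + (z - y) * y) (w - y).
    have t2 := ler_cnormD (z * (z - y)) ((z - y) * y).
    have t3 := ler_cnormM z (z - y); have t4 := ler_cnormM (z - y) y.
    have zy0 := cnorm_ge0 (z - y).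
    have t5 : cnorm z * cnorm (z - y) <= cnorm (z - y) by rewrite ler_piMl ?in1.
    have t6 : cnorm (z - y) * cnorm y <= cnorm (z - y) by rewrite ler_piMr.
    lra.
  transitivity (1 - c + (c + y * y - (y + y))).
    by rewrite mulrBr mulr1 mulrBl mul1r; zmodule.
  by rewrite E subrr addr0.
- move=> x xc; apply/eqP; rewrite -subr_eq0; apply/eqP.
  apply: (@cnorm_small _ (2 * cnorm x)) => e e0.
  have [N /(_ N (leqnn _)) hN] := hy e e0; set z := sqrt_iter c N in hN.
  have xz : x * z = z * x.
    rewrite /z; elim: N {hN z} => [|n ih]; first by rewrite mulr0 mul0r.
    rewrite /= -/(sqrt_iter c n) /sqrt_step -scalerAr -scalerAl.
    by rewrite mulrDr mulrDl xc mulrA ih -mulrA ih mulrA.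
  have -> : x * y - y * x = (z - y) * x - x * (z - y).
    by rewrite mulrBl mulrBr xz opprB [RHS]addrC addrA subrK.
  rewrite (le_trans (ler_cnormB _ _))//.
  have := ler_cnormM (z - y) x; have := ler_cnormM x (z - y).
  have := cnorm_ge0 x; nra.
Qed.

End StarNorm.

(** * Positive elements of C*-algebras *)

Section Positivity.
Variables (R : realType) (B : cstarType R).
Implicit Types a b c h g k x y : B.

Let mulCii : 'i%R * 'i%R = -1 :> R[i]. Proof. by rewrite -expr2 sqrCi. Qed.

(** For self-adjoint h this says that the spectrum of h lies in the disc with centre t
and radius t for some t, hence in the half line of nonnegative reals. The form of
the condition makes sums of positive elements visibly positive. *)
Definition cpos h := star h = h /\ exists t : R, cnorm (t%:C%:A - h) <= t.

Lemma cpos_radius h : cpos h ->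
  exists2 t : R, 0 < t & cnorm (t%:C%:A - h) <= t.
Proof.
move=> [_ [t ht]]; have t0 := le_trans (cnorm_ge0 _) ht.
exists (t + 1); first by rewrite ltr_wpDl.
have -> : (t + 1)%:C%:A - h = t%:C%:A - h + 1%:C%:A.
  by rewrite rmorphD/= scalerDl; zmodule.
by rewrite (le_trans (ler_cnormD _ _))// cnorm_real1// lerD.
Qed.

Lemma cposD h g : cpos h -> cpos g -> cpos (h + g).
Proof.
move=> [sh [t ht]] [sg [u gu]]; split; first by rewrite raddfD/= sh sg.
exists (t + u); apply: le_trans (lerD ht gu); apply: le_trans (ler_cnormD _ _).
rewrite le_eqVlt; apply/orP; left; apply/eqP; congr cnorm.
by rewrite rmorphD/= scalerDl; zmodule.
Qed.

Lemma cposZ (r : R) h : 0 <= r -> cpos h -> cpos (r%:C *: h).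
Proof.
move=> r0 [sh [t ht]]; split; first by rewrite starZr sh.
exists (r * t); rewrite rmorphM/= -scalerA -scalerBr cnormZr ger0_norm//.
exact: ler_wpM2l.
Qed.

Lemma cpos_norm_sub (r : R) x : star x = x -> cnorm x <= r ->
  cpos (r%:C%:A - x).
Proof.
move=> sx xr; split; first by rewrite raddfB/= starZr star1 sx.
by exists r; rewrite subKr.
Qed.

(** After scaling, h = 1 - c with c in the unit ball. *)
Lemma cpos_sqrt h : cpos h -> exists k, [/\ cpos k, k * k = h
  & forall x, x * h = h * x -> x * k = k * x].
Proof.
move=> ph; have [sh _] := ph; have [t t0 ht] := cpos_radius ph.
have [||y [sy y1 yy yc]] := @sqrt_one_sub R B (1 - (t^-1)%:C *: h).
- by rewrite raddfB/= star1 starZr sh.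
- rewrite -(ler_pM2l t0) mulr1; apply: le_trans ht; rewrite -{1}(gtr0_norm t0).
  rewrite -cnormZr scalerBr scalerA -rmorphM/= divff ?gt_eqF//.
  by rewrite scale1r.
have pk : cpos (1 - y) by have := cpos_norm_sub sy y1; rewrite scale1r.
exists ((Num.sqrt t)%:C *: (1 - y)); split.
- by apply: cposZ => //; rewrite sqrtr_ge0.
- rewrite -scalerAl -scalerAr scalerA -rmorphM/= -expr2 sqr_sqrtr ?ltW//.
  rewrite yy subKr scalerA -rmorphM/= divff ?gt_eqF//; exact: scale1r.
- move=> x xh; have := yc x.
  rewrite mulrBr mulrBl mulr1 mul1r -scalerAr -scalerAl xh => /(_ erefl) xy.
  by rewrite -scalerAr -scalerAl mulrBr mulrBl mulr1 mul1r xy.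
Qed.

(** For commuting self-adjoint x and y the element u = x + i y is normal with
[star u * u = x * x + y * y], and x is its real part. *)
Lemma cnorm_comm_sa x y : star x = x -> star y = y -> x * y = y * x ->
  cnorm x ^+ 2 <= cnorm (x * x + y * y).
Proof.
move=> sx sy xy; pose u := x + 'i%R *: y.
have su : star u = x - 'i%R *: y.
  by rewrite raddfD/= starZ conjCi sx sy scaleNr.
have -> : x * x + y * y = star u * u.
  rewrite su mulrBl !mulrDr -!scalerAl -!scalerAr scalerA xy mulCii.
  by rewrite scaleN1r; zmodule.
rewrite cnorm_star ler_pXn2r ?nnegrE ?cnorm_ge0//.
have -> : x = (2^-1 : R)%:C *: (u + star u).
  rewrite su (_ : u + _ = x + x); last by rewrite /u; zmodule.
  by rewrite scalerDr -scalerDl -rmorphD/= (_ : 2^-1 + 2^-1 = 1 :> R) ?scale1r//; lra.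
rewrite cnormZr ger0_norm ?invr_ge0//.
have := ler_cnormD u (star u); rewrite cnorm_starE; lra.
Qed.

(** If k is the square root of |x|^2 - x * x, then x + i k is a multiple of a unitary,
so that |k| <= |x|; this is the required estimate for the radius |x|^2. *)
Lemma cpos_sqr x : star x = x -> cpos (x * x).
Proof.
move=> sx; split; first by rewrite starM sx.
exists (cnorm x ^+ 2).
have [|k [[sk _] kk kc]] := @cpos_sqrt ((cnorm x ^+ 2)%:C%:A - x * x).
  apply: cpos_norm_sub; first by rewrite starM sx.
  by rewrite cnorm_sqr_sa.
rewrite -kk cnorm_sqr_sa//.
apply: le_trans (@cnorm_comm_sa k x _ _ _) _ => //.
  by rewrite [RHS]kc// mulrBr mulrBl -scalerAl -scalerAr mulr1 mul1r mulrA.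
by rewrite kk subrK cnorm_real1// sqr_ge0.
Qed.

Lemma cposM h g : cpos h -> cpos g -> h * g = g * h -> cpos (h * g).
Proof.
move=> ph pg hg.
have [k [[sk _] kk kc]] := cpos_sqrt ph; have [l [[sl _] ll lc]] := cpos_sqrt pg.
have kl : k * l = l * k by rewrite [LHS]lc// [RHS]kc.
have -> : h * g = (k * l) * (k * l).
  by rewrite -kk -ll -mulrA -[RHS]mulrA; congr (_ * _); rewrite [LHS]mulrA {1}kl -mulrA.
by apply: cpos_sqr; rewrite starM sk sl.
Qed.

(** The product of h and - h is a square m * m, so h * h + m * m = 0 and
[cnorm_comm_sa] applies. *)
Lemma cpos_anti h : cpos h -> cpos (- h) -> h = 0.
Proof.
move=> ph pNh; have [sh _] := ph.
have [|m [[sm _] mm mc]] := @cpos_sqrt (h * - h).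
  by apply: cposM; rewrite ?mulrN ?mulNr.
have /= := @cnorm_comm_sa h m sh sm.
rewrite mm mulrN subrr cnorm0 => hm; apply: cnorm_eq0; apply/eqP.
rewrite -sqrf_eq0 eq_le sqr_ge0 andbT hm//; apply: mc.
by rewrite !(mulrN, mulNr) mulrA.
Qed.

(** The C*-identity turns the norm into a spectral radius on self-adjoint elements. *)
Lemma cnorm_exp2 x n : star x = x -> cnorm (x ^+ (2 ^ n)) = cnorm x ^+ (2 ^ n).
Proof.
move=> sx.
have sX m : star (x ^+ m) = x ^+ m.
  by elim: m => [|m ih]; rewrite ?star1// {1}exprS starM ih sx -exprSr.
by elim: n => // n ih; rewrite expnSr !exprM expr2 cnorm_sqr_sa// ih.
Qed.

(** Exponential growth beats linear growth. *)
Lemma le1_exp2 (r M : R) : 0 <= r ->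
  (forall n, r ^+ (2 ^ n) <= 1 + (2 ^ n)%:R * M) -> r <= 1.
Proof.
move=> r0 hr; rewrite leNgt; apply/negP => r1; pose e := r - 1.
have e0 : 0 < e by rewrite subr_gt0.
have bern n : 1 + n%:R * e <= r ^+ n.
  elim: n => [|n ih]; first by rewrite mul0r addr0.
  rewrite exprS -natr1; have : r = 1 + e by rewrite /e; lra.
  have n0 : 0 <= n%:R :> R by []. 
  move: ih; set p := r ^+ n => ih ->; nra.
have M0 : 0 <= M by have := hr 0%N; rewrite expr1; lra.
pose K := (1 + 2 * M) / e ^+ 2.
have [k hk] : exists k : nat, K < (2 ^ k)%:R.
  by exists (Num.bound K); rewrite natrX; apply: upper_nthrootP.
have := hr k.+1; have := bern (2 ^ k)%N.
rewrite expnSr exprM natrM; set p := r ^+ _; set n : R := (2 ^ k)%:R in hk *.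
have n1 : 1 <= n by rewrite /n ler1n expn_gt0.
move: hk; rewrite /K ltr_pdivrMr ?exprn_gt0// => hk h1 h2.
have ne0 : 0 <= n * e by rewrite mulr_ge0 ?(ltW e0)// (le_trans ler01).
have : (n * e) ^+ 2 <= p ^+ 2.
  by rewrite ler_pXn2r ?nnegrE ?exprn_ge0//; lra.
rewrite exprMn => h3.
have : n * (n * e ^+ 2 - 2 * M) <= 1 by rewrite mulrBr mulrA -expr2; lra.
apply/negP; rewrite -ltNge; apply: lt_le_trans (_ : 1 < n * e ^+ 2 - 2 * M) _.
  by lra.
by rewrite ler_peMl//; lra.
Qed.

(** The elements b * star b and star b * b have the same spectrum up to 0. In terms of
norms: (1 - star b * b) ^ n differs from 1 by a sum of n terms
star b * (1 - b * star b) ^ i * b, which grows linearly in n, so the spectral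
radius of 1 - star b * b is at most 1. *)
Lemma cnorm_swap1 b : cnorm (1 - b * star b) <= 1 -> cnorm (1 - star b * b) <= 1.
Proof.
move=> h; pose p := 1 - star b * b.
have E n : exists2 e : B, cnorm e <= n%:R & p ^+ n = 1 - star b * e * b.
  elim: n => [|n [e en pe]].
    by exists 0; rewrite ?cnorm0// mulr0 mul0r subr0.
  exists (1 + e * (1 - b * star b)).
    rewrite -natr1 addrC (le_trans (ler_cnormD _ _))// cnorm1 lerD//.
    by rewrite (le_trans (ler_cnormM _ _))// (le_trans _ en)// ler_piMr ?cnorm_ge0.
  rewrite exprSr pe /p !(mulrBr, mulrBl, mulrDr, mulrDl) !mulr1 !mul1r !mulrA.
  by zmodule.
apply: (@le1_exp2 _ (cnorm b ^+ 2)); first exact: cnorm_ge0.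
move=> n; rewrite -cnorm_exp2; last first.
  by rewrite raddfB/= star1 starM starK.
have [e en ->] := E (2 ^ n)%N.
rewrite (le_trans (ler_cnormB _ _))// cnorm1 lerD2l mulrC.
apply: le_trans (ler_cnormM _ _) _; rewrite expr2 mulrAC ler_wpM2r ?cnorm_ge0//.
apply: le_trans (ler_cnormM _ _) _; rewrite cnorm_starE ler_wpM2l ?cnorm_ge0//.
Qed.

Lemma cpos_swap b : cpos (b * star b) -> cpos (star b * b).
Proof.
move=> pb; have [t t0 ht] := cpos_radius pb.
pose d := ((Num.sqrt t)^-1)%:C *: b.
have q0 : 0 < Num.sqrt t by rewrite sqrtr_gt0.
have E x y : ((Num.sqrt t)^-1)%:C *: x * (((Num.sqrt t)^-1)%:C *: y) =
    (t^-1)%:C *: (x * y).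
  by rewrite -scalerAl -scalerAr scalerA -rmorphM/= -invfM -expr2 sqr_sqrtr ?ltW.
have F x : t%:C *: (1 - (t^-1)%:C *: x) = t%:C%:A - x.
  by rewrite scalerBr scalerA -rmorphM/= divff ?gt_eqF// scale1r.
split; first by rewrite starM starK.
exists t; have := @cnorm_swap1 d; rewrite starZr !E => h.
rewrite -F cnormZr gtr0_norm// -[leRHS]mulr1 ler_pM2l// h//.
by rewrite -(ler_pM2l t0) mulr1 -{1}(gtr0_norm t0) -cnormZr F.
Qed.

(** Let h = star a * a, let g be its absolute value and v = (g - h) / 2 its negative
part, so that v * h = - v * v. For b = a * v the element star b * b = - v ^ 3 is
negative. As star b * b + b * star b is a sum of two squares, b * star b is
positive, hence so is star b * b by [cpos_swap]. Thus v ^ 3 = 0, v = 0 and h = g. *)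
Theorem cpos_star_mul a : cpos (star a * a).
Proof.
pose h := star a * a; have sh : star h = h by rewrite /h starM starK.
have [g [pg gg gc]] := cpos_sqrt (cpos_sqr sh); have [sg _] := pg.
have hg : h * g = g * h by apply: gc; rewrite mulrA.
pose v := (2^-1 : R)%:C *: (g - h).
have sv : star v = v by rewrite starZr raddfB/= sg sh.
have half x : (2^-1 : R)%:C *: x + (2^-1 : R)%:C *: x = x.
  rewrite -scalerDl -rmorphD/= (_ : 2^-1 + 2^-1 = 1 :> R) ?scale1r//; lra.
have vv : v * v = (2^-1 : R)%:C *: (h * h - g * h).
  rewrite -[RHS]half /v -scalerAl -scalerAr -!scalerDr; congr (_ *: (_ *: _)).
  by rewrite mulrBr !mulrBl gg hg; zmodule.
have vh : v * h = - (v * v).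
  by rewrite vv /v -scalerAl -scalerN mulrBl opprB.
have vg : v * g = v * v by rewrite vv /v -scalerAl mulrBl gg hg.
have gv : g * v = v * v by rewrite vv /v -scalerAr mulrBr gg.
have [k [[sk _] kk kc]] := cpos_sqrt pg.
have vk : v * k = k * v by apply: kc; rewrite vg gv.
pose b := a * v.
have bb : star b * b = - (v * v * v).
  by rewrite /b starM sv -[LHS]mulrA (mulrA (star a)) -/h mulrA vh mulNr.
have pN : cpos (- (star b * b)).
  rewrite bb opprK -mulrA -gv mulrA (_ : v * g * v = v * k * (v * k)).
    by apply: cpos_sqr; rewrite starM sv sk.
  by rewrite {2}vk mulrA -(mulrA v k) kk.
have pD : cpos (star b * b + b * star b).
  have sx : star (b + star b) = b + star b by rewrite raddfD/= starK addrC.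
  have sy : star ('i%R *: (b - star b)) = 'i%R *: (b - star b).
    by rewrite starZ raddfB/= starK conjCi scaleNr -scalerN opprB.
  have := cposZ (_ : 0 <= 2^-1) (cposD (cpos_sqr sx) (cpos_sqr sy)).
  rewrite -scalerAl -scalerAr scalerA mulCii scaleN1r.
  have -> : (b + star b) * (b + star b) - (b - star b) * (b - star b)
    = (star b * b + b * star b) + (star b * b + b * star b).
    by rewrite !mulrDl !mulrDr !mulNr !mulrN; zmodule.
  by rewrite scalerDr half; apply; rewrite invr_ge0.
have pb : cpos (star b * b).
  apply: cpos_swap.
  by rewrite -[_ * _](addKr (star b * b)); apply: cposD.
have v3 : v * v * v = 0.
  by apply: oppr_inj; rewrite -bb oppr0 (cpos_anti pb pN).
have v0 : v = 0.
  have /eqP : cnorm v ^+ 4 = 0.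
    rewrite (exprM _ 2 2) -cnorm_sqr_sa// -cnorm_sqr_sa; last by rewrite starM sv.
    by rewrite mulrA v3 mul0r cnorm0.
  by rewrite expf_eq0 => /eqP/cnorm_eq0.
move: v0 => /eqP; rewrite scaler_eq0 => /orP[|].
  by rewrite (fmorph_eq0 (real_complex R)) invr_eq0 pnatr_eq0.
by rewrite subr_eq0 => /eqP gh; rewrite -/h -gh.
Qed.

Lemma cpos_real (r : R) : cpos (r%:C%:A : B) -> 0 <= r.
Proof.
move=> pr; rewrite leNgt; apply/negP => r0.
have p : cpos (- (r%:C%:A : B)).
  rewrite -[X in cpos X]addr0 -scaleNr -rmorphN/=. 
  have := cposZ (_ : 0 <= - r) (cpos_sqr (star1 B)); rewrite mulr1 addr0; apply.
  by rewrite oppr_ge0 ltW.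
have /eqP := cpos_anti pr p.
by rewrite scaler_eq0 oner_eq0 orbF (fmorph_eq0 (real_complex R)) lt_eqF.
Qed.

End Positivity.

(** * Separation of a convex cone from a point *)

Section ConeSeparation.
Variables (R : realType) (V : lmodType R[i]) (e : V).
Implicit Types (u v : V) (P Q : set V) (r t : R).

Definition proper_cone P :=
  [/\ forall u v, P u -> P v -> P (u + v),
      forall r v, 0 <= r -> P v -> P (r%:C *: v)
    & ~ P (- e)].

(** Zorn's lemma is applied to the sets whose union with P0 is a proper cone, so that
the empty chain is bounded by the empty set. *)
Lemma maximal_cone P0 : proper_cone P0 ->
  exists P, [/\ proper_cone P, P0 `<=` P
    & forall Q, proper_cone Q -> P `<=` Q -> Q `<=` P].
Proof.
move=> c0; have [|A [pA mA]] :=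
    @Zorn_bigcup V [set A | proper_cone (A `|` P0)].
  move=> F FP tF; split.
  - have big X u v : F X -> (X `|` P0) u -> (X `|` P0) v ->
      (\bigcup_(X0 in F) X0 `|` P0) (u + v).
      move=> FX Xu Xv; have [/(_ u v Xu Xv) + _ _] := FP _ FX.
      by move=> [?|?]; [left; exists X|right].
    move=> u v [[X FX Xu]|P0u] [[Y FY Yv]|P0v].
    + have [XY|YX] := tF _ _ FX FY.
      * by apply: (big Y) => //; left=> //; exact: XY.
      * by apply: (big X) => //; left=> //; exact: YX.
    + by apply: (big X) => //; [left|right].
    + by apply: (big Y) => //; [right|left].
    + by right; case: c0 => c0 _ _; exact: c0.
  - move=> r v r0 [[X FX Xu]|P0u].
      have [_ /(_ r v r0 (or_introl Xu)) + _] := FP _ FX.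
      by move=> [?|?]; [left; exists X|right].
    by right; case: c0 => _ c0 _; exact: c0.
  - case=> [[X FX Xe]|P0e]; last by case: c0.
    by have [_ _] := FP _ FX; apply; left.
exists (A `|` P0); split=> // Q cQ PQ v Qv; apply: contrapT => nPv.
apply: (mA Q); last first.
  by rewrite /= (_ : Q `|` P0 = Q)//; apply/setUidPl => u P0u; apply: PQ; right.
split; first by move=> u Au; apply: PQ; left.
by move=> QA; apply: nPv; left; exact: QA.
Qed.

(** If neither v nor - v belongs to P, then the cone spanned by P and v is still
proper: an equality - e = p + r v with r > 0 would put - v in P. *)
Lemma maximal_cone_total P v : proper_cone P ->
  (forall Q, proper_cone Q -> P `<=` Q -> Q `<=` P) -> P e ->
  P v \/ P (- v).
Proof.
move=> [PD PZ Pe] mP Pe1; have P0 : P 0 by rewrite -(scale0r e); exact: (PZ 0).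
apply: contrapT => /not_orP[nPv nPNv].
pose Q : set V := [set w | exists r p, [/\ 0 <= r, P p & w = p + r%:C *: v]].
apply: nPv; apply: (mP Q).
- split.
  + move=> _ _ [r [p [r0 Pp ->]]] [t [q [t0 Pq ->]]].
    exists (r + t), (p + q); split; [exact: addr_ge0|exact: PD|].
    by rewrite rmorphD/= scalerDl addrACA.
  + move=> t _ t0 [r [p [r0 Pp ->]]].
    exists (t * r), (t%:C *: p); split; [exact: mulr_ge0|exact: PZ|].
    by rewrite scalerDr scalerA rmorphM.
  + move=> [r [p [r0 Pp E]]]; have [r_0|r_gt0] := leP r 0.
      apply: Pe; rewrite E (_ : r = 0) ?scale0r ?addr0//.
      by apply/eqP; rewrite eq_le r_0.
    apply: nPNv; have -> : - v = (r^-1)%:C *: (p + e).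
      have -> : p + e = r%:C *: - v.
        rewrite scalerN; apply/eqP.
        by rewrite -subr_eq0 opprK addrAC -E addNr.
      by rewrite scalerA -rmorphM/= mulVf ?gt_eqF// scale1r.
    by apply: PZ; [rewrite invr_ge0|exact: PD].
- by move=> p Pp; exists 0, p; rewrite scale0r addr0.
- by exists 1, 0; rewrite scale1r add0r.
Qed.

(** A maximal proper cone makes V totally preordered, with order unit e, and the
functional is read off as a Dedekind cut along the line spanned by e. *)
Lemma cone_functional P0 : proper_cone P0 -> P0 e ->
  (forall v, exists t, P0 (t%:C *: e - v)) ->
  exists f : V -> R, [/\ forall u v, f (u + v) = f u + f v,
    forall r v, f (r%:C *: v) = r * f v,
    forall v, P0 v -> 0 <= f v & f e = 1].
Proof.
move=> c0 P0e unit0; have [P [cP P0P mP]] := maximal_cone c0.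
have {}unit0 v : exists t, P (t%:C *: e - v).
  by have [t /P0P] := unit0 v; exists t.
have [PD PZ PNe] := cP.
have P0_ : P 0 by have [t /(PZ 0)] := unit0 0; rewrite scale0r; apply.
have Pr r : P (r%:C *: e) -> 0 <= r.
  move=> Pre; rewrite leNgt; apply/negP => r0; apply: PNe.
  have := PZ (- r)^-1 _ _ Pre; rewrite scalerA -rmorphM/= invrN mulNr mulVf ?lt_eqF//.
  by rewrite rmorphN/= scaleNr scale1r; apply; rewrite -invrN invr_ge0 oppr_ge0 ltW.
have Pe1 : P e by exact: P0P.
have tot v := maximal_cone_total v cP mP Pe1.
pose cut v c := forall d : R, 0 < d ->
  P ((c + d)%:C *: e - v) /\ P (v - (c - d)%:C *: e).
have cut_uniq v c c' : cut v c -> cut v c' -> c <= c'.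
  move=> h h'; apply/ler_addgt0Pr => d d0.
  have [|_ h1] := h (d / 2); first by rewrite divr_gt0.
  have [|h2 _] := h' (d / 2); first by rewrite divr_gt0.
  have := PD _ _ h1 h2; rewrite addrC addrA subrK -scalerBl -rmorphB/= => /Pr.
  lra.
have cutD u v c d : cut u c -> cut v d -> cut (u + v) (c + d).
  move=> h h' x x0; have x2 : 0 < x / 2 by rewrite divr_gt0.
  have [h1 h2] := h _ x2; have [h3 h4] := h' _ x2.
  split.
    have := PD _ _ h1 h3; rewrite addrACA -opprD -scalerDl -rmorphD/=.
    by rewrite (_ : c + x / 2 + _ = c + d + x); last by lra.
  have := PD _ _ h2 h4; rewrite addrACA -opprD -scalerDl -rmorphD/=.
  by rewrite (_ : c - _ + _ = c + d - x); last by lra.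
have cutN v c : cut v c -> cut (- v) (- c).
  move=> h x x0; have [h1 h2] := h _ x0; split.
    rewrite opprK [X in P X]addrC (_ : - c + x = - (c - x)) ?rmorphN ?scaleNr//; lra.
  rewrite (_ : - c - x = - (c + x)); last by rewrite opprD.
  by rewrite rmorphN scaleNr opprK addrC.
have cutZ r v c : 0 < r -> cut v c -> cut (r%:C *: v) (r * c).
  move=> r0 h x x0; have [|h1 h2] := h (x / r); first exact: divr_gt0.
  have rx : r * (x / r) = x by rewrite mulrCA divff ?gt_eqF// mulr1.
  split.
    by have := PZ r _ (ltW r0) h1; rewrite scalerBr scalerA -rmorphM/= mulrDr rx.
  by have := PZ r _ (ltW r0) h2; rewrite scalerBr scalerA -rmorphM/= mulrBr rx.
have cut_ex v : exists c, cut v c.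
  pose L := [set t : R | P (t%:C *: e - v)].
  have [t0 Lt0] := unit0 v; have [s0 Ls0] := unit0 (- v).
  have hL : has_inf L.
    split; first by exists t0.
    exists (- s0) => t Lt; have := PD _ _ Lt Ls0.
    rewrite opprK addrACA addNr addr0 -scalerDl -rmorphD/= => /Pr; lra.
  exists (inf L) => d d0; split.
    have [t Lt td] := inf_adherent d0 hL.
    have -> : (inf L + d)%:C *: e - v = (inf L + d - t)%:C *: e + (t%:C *: e - v).
      by rewrite addrA -scalerDl -rmorphD/= subrK.
    by apply: PD => //; apply: PZ => //; lra.
  case: (tot (v - (inf L - d)%:C *: e)) => //; rewrite opprB => Ld.
  have : inf L <= inf L - d by apply: ge_inf => //; case: hL.
  lra.
pose f v := xget 0 [set c | cut v c].
have fP v : cut v (f v).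
  rewrite /f; case: xgetP => [c _ //|].
  by have [c /[swap] /(_ c)] := cut_ex v.
have fE v c : cut v c -> f v = c.
  by move=> h; apply/eqP; rewrite eq_le !(@cut_uniq v).
exists f; split.
- by move=> u v; apply/fE/cutD.
- move=> r v; have [r0|r0|->] := ltgtP r 0.
  + rewrite -[r]opprK rmorphN/= scaleNr mulNr; apply/fE/cutN/cutZ => //.
    by rewrite oppr_gt0.
  + exact/fE/cutZ.
  + rewrite scale0r mul0r; apply: fE => d d0.
    rewrite !subr0 add0r !sub0r rmorphN/= scaleNr opprK.
    by split; apply: PZ => //; exact: ltW.
- move=> v /P0P Pv; apply/ler_addgt0Pr => d d0; have [h _] := fP v d d0.
  by have := PD _ _ h Pv; rewrite subrK => /Pr.
- apply: fE => d d0.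
  have E r : r%:C *: e - e = (r - 1)%:C *: e.
    by rewrite rmorphB/= scalerBl scale1r.
  rewrite -[e - _]opprB !E -scaleNr -rmorphN.
  by split; apply: PZ => //; lra.
Qed.

(** A real linear functional f is the real part of the complex linear functional
v |-> f v - i f (i v). *)
Theorem cone_separation P0 : proper_cone P0 -> P0 e ->
  (forall v, exists t, P0 (t%:C *: e - v)) ->
  exists s : {scalar V}, (forall v, P0 v -> 0 <= complex.Re (s v)) /\
    complex.Re (s e) = 1.
Proof.
move=> c0 P0e u0; have [f [fD fZ fP fe]] := cone_functional c0 P0e u0.
pose g v : R[i] := Complex (f v) (- f ('i%R *: v)).
have gl : scalar g.
  move=> [x y] u v.
  have E : (x +i* y) = x%:C + y%:C * 'i%R :> R[i] by rewrite [LHS]complexE /= mulrC.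
  have fa w : f ((x +i* y) *: w) = x * f w + y * f ('i%R *: w).
    by rewrite E scalerDl fD fZ -scalerA fZ.
  have fN w : f (- w) = - f w.
    by rewrite -scaleN1r -[-1](rmorphN1 (real_complex R)) fZ mulN1r.
  rewrite /g scalerDr !fD scalerA mulrC -scalerA !fa scalerA -expr2 sqrCi scaleN1r fN.
  by apply/eqP; rewrite eq_complex /=; apply/andP; split; apply/eqP; ring.
pose s : {scalar V} := HB.pack g (GRing.isLinear.Build _ _ _ _ g gl).
by exists s.
Qed.

End ConeSeparation.

(** * The dominating state *)

Section DominatingState.
Variables (R : realType) (B : cstarType R).
Variables (Z : lmodType R[i]) (j : {linear Z -> B}).
Variables (H : normedModType R[i]) (xi : {linear Z -> H}).
Local Notation C := R[i].
Implicit Types (z : Z) (zs : seq Z) (b : B).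

(** In terms of matrix norms: the column with entries xi z has norm at most that of
the column with entries j z. *)
Definition column_contractive := forall zs (r : R), 0 <= r ->
  cpos (r%:C%:A - \sum_(z <- zs) star (j z) * j z) ->
  \sum_(z <- zs) `|xi z| ^+ 2 <= r%:C.

Hypothesis xi_contractive : column_contractive.

Let sqn z : R := complex.Re (`|xi z| ^+ 2).

Let sqnE z : (sqn z)%:C = `|xi z| ^+ 2.
Proof. by rewrite RRe_real// rpredX// normr_real. Qed.

(** The dominating state has to be nonnegative on these elements. *)
Let gap z : B := star (j z) * j z - (sqn z)%:C%:A.

Let star_gap z : star (gap z) = gap z.
Proof. by rewrite raddfB/= starM starK starZr star1. Qed.

(** Scaling by r is absorbed in z, so the gaps generate a cone by sums alone. *)
Let gapZ (r : R) z : 0 <= r -> gap ((Num.sqrt r)%:C *: z) = r%:C *: gap z.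
Proof.
move=> r0; rewrite /gap linearZ/= starZr -scalerAl -scalerAr scalerA.
rewrite -rmorphM/= -expr2 sqr_sqrtr// scalerBr scalerA -rmorphM/=.
congr (_ - _ *: _).
rewrite rmorphM/= !sqnE linearZ normrZ exprMn -normrX -rmorphXn/= sqr_sqrtr//.
by rewrite ger0_norm// ler0c.
Qed.

Let P0 : set B :=
  [set b | exists zs, cpos (b + star b - \sum_(z <- zs) gap z)].

Let sum_gap zs : \sum_(z <- zs) gap z =
  \sum_(z <- zs) star (j z) * j z - (\sum_(z <- zs) sqn z)%:C%:A.
Proof. by rewrite sumrB -scaler_suml -rmorph_sum. Qed.

Let cpos_sum zs : cpos (\sum_(z <- zs) star (j z) * j z).
Proof.
apply: (big_ind (@cpos R B)) => [|x y|z _]; last exact: cpos_star_mul.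
  by rewrite -(mul0r 0); apply: cpos_sqr; rewrite raddf0.
exact: cposD.
Qed.

Let P0_proper : proper_cone 1 P0.
Proof.
split.
- move=> u v [zs hz] [ys hy]; exists (zs ++ ys); rewrite big_cat/= raddfD/=.
  by rewrite addrACA opprD [X in cpos X]addrACA; exact: cposD.
- move=> r v r0 [zs hz]; exists [seq (Num.sqrt r)%:C *: z | z <- zs].
  rewrite big_map starZr -scalerDr.
  under eq_bigr do rewrite gapZ//.
  by rewrite -scaler_sumr -scalerBr; exact: cposZ.
- move=> [zs]; rewrite raddfN/= star1 sum_gap.
  set S := \sum_(z <- zs) sqn z => p.
  have p2 : cpos ((S - 2)%:C%:A - \sum_(z <- zs) star (j z) * j z).
    set x := (X in cpos X) in p; rewrite [X in cpos X](_ : _ = x)//.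
    by rewrite rmorphB/= scalerBl rmorphD/= scalerDl scale1r /x; zmodule.
  have r0 : 0 <= S - 2.
    by have := cposD p2 (cpos_sum zs); rewrite subrK => /cpos_real.
  have := xi_contractive r0 p2.
  under eq_bigr do rewrite -sqnE.
  rewrite -rmorph_sum lecR -/S; lra.
Qed.

Let P0_pos b : star b = b -> cpos b -> P0 b.
Proof. by move=> sb pb; exists [::]; rewrite big_nil subr0 sb; exact: cposD. Qed.

(** If b is self-adjoint then i b and - i b both belong to the cone, as only the sum of
an element and its star enters the definition. The functional is therefore real on
self-adjoint elements. *)
Theorem dominating_state : exists s : {scalar B},
  is_state s /\ forall z, `|xi z| ^+ 2 <= s (star (j z) * j z).
Proof.
have p1 : cpos (1 : B) by rewrite -{1}star1 -[star 1]mulr1; exact: cpos_star_mul.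
have [| | |s [sP s1]] := @cone_separation R B 1 P0.
- exact: P0_proper.
- by apply: P0_pos => //; rewrite star1.
- move=> v; exists (cnorm (v + star v) / 2), [::]; rewrite big_nil subr0.
  rewrite raddfB/= starZr star1; set t : R := cnorm _ / 2.
  have -> : t%:C%:A - v + (t%:C%:A - star v) = (t + t)%:C%:A - (v + star v).
    by rewrite rmorphD/= scalerDl; zmodule.
  apply: cpos_norm_sub; first by rewrite raddfD/= starK addrC.
  by rewrite /t; lra.
have sIm b : star b = b -> complex.Im (s b) = 0.
  move=> sb; have skew (c : C) : (c^*)%R = - c -> 0 <= complex.Re (c * s b).
    move=> cN; rewrite -linearZ; apply: sP; exists [::].
    rewrite big_nil subr0 starZ sb cN scaleNr subrr.
    by rewrite -(mul0r 0); apply: cpos_sqr; rewrite raddf0.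
  have := skew 'i%R (conjCi _); have := skew (- 'i%R).
  rewrite raddfN/= conjCi => /(_ erefl); case: (s b) => x y /=.
  by move=> h1 h2; apply/eqP; rewrite eq_le; lra.
have spos b : star b = b -> P0 b -> 0 <= s b.
  by move=> sb Pb; rewrite lecE /= sIm// eqxx sP.
exists s; split; first split.
- move=> b; have sb : star (star b * b) = star b * b by rewrite starM starK.
  by apply: spos => //; apply: P0_pos => //; exact: cpos_star_mul.
- by apply/eqP; rewrite eq_complex s1 sIm ?star1//= !eqxx.
- move=> z; have : 0 <= s (gap z).
    apply: spos => //; exists [:: z; z].
    rewrite big_cons big_seq1 star_gap subrr.
    by rewrite -(mul0r 0); apply: cpos_sqr; rewrite raddf0.
  rewrite linearB linearZ /= (_ : s 1 = 1) ?mulr1 ?sqnE ?subr_ge0//.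
  by apply/eqP; rewrite eq_complex s1 sIm ?star1//= !eqxx.
Qed.

End DominatingState.

(** * Semi-inner products *)

Section SemiInner.
Variable R : realType.
Local Notation C := R[i].

(** The scalar content of the Cauchy-Schwarz inequality, for a quadratic expression in
one complex variable; reality of its values makes the linear coefficients conjugate. *)
Lemma psd_quadratic (a b b' c : C) : 0 <= c ->
  (forall t : C, 0 <= a + t * b + (t^*)%R * b' + t * (t^*)%R * c) ->
  b' = (b^*)%R /\ `|b| ^+ 2 <= a * c.
Proof.
move=> c0 h.
have hJ t : ((a + t * b + (t^*)%R * b' + t * (t^*)%R * c)^*)%R =
    a + t * b + (t^*)%R * b' + t * (t^*)%R * c.
  by apply: conj_Creal; apply: ger0_real.
have a0 : 0 <= a by have := h 0; rewrite rmorph0 !mul0r !addr0.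
have cJ : (c^*)%R = c by apply: conj_Creal; apply: ger0_real.
have aJ : (a^*)%R = a by apply: conj_Creal; apply: ger0_real.
(* The values at t = 1 and t = 'i are real. *)
have bb' : b' = (b^*)%R.
  have := hJ 1; have := hJ 'i%R; rewrite !rmorphD !rmorphM /= !rmorph1 conjCi.
  rewrite rmorphN/= conjCi !opprK cJ aJ => h1 h2.
  have ii : 'i%R != 0 :> C by rewrite neq0Ci.
  move/eqP: h1; rewrite -subr_eq0 => /eqP h1.
  move/eqP: h2; rewrite -subr_eq0 => /eqP h2.
  have h5 : (b'^*)%R = b.
    have : 2 * 'i%R * ((b'^*)%R - b) = 0.
      have := congr2 +%R h1 (congr1 ( *%R 'i%R) h2); rewrite mulr0 addr0.
      by move=> <-; ring.
    by move/eqP; rewrite !mulf_eq0 pnatr_eq0/= (negPf ii)/= subr_eq0 => /eqP.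
  by rewrite -h5 conjCK.
split=> //; rewrite {}bb' in h hJ.
set N := `|b| ^+ 2; have N0 : 0 <= N by rewrite exprn_ge0.
have hr (r : R) : 0 <= a - r%:C * N - r%:C * N + r%:C * r%:C * (N * c).
  have := h (- r%:C * (b^*)%R); rewrite rmorphM rmorphN/= conjCK.
  have -> : ((r%:C)^*)%R = r%:C by apply: conj_Creal; rewrite complex_real.
  by rewrite /N normCK; congr (0 <= _); ring.
(* The minimum over real r is at 1 / c; for c = 0 the expression is affine in r and
   stays nonnegative only if N = 0. *)
have [c_0|c_n0] := eqVneq c 0; last first.
  have cr : c = (complex.Re c)%:C by rewrite RRe_real// ger0_real.
  have := hr (complex.Re c)^-1; rewrite fmorphV/= -cr.
  rewrite (_ : _ + _ = a - c^-1 * N); last by field.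
  rewrite subr_ge0 -(ler_pM2l (_ : 0 < c)); last by rewrite lt_def c_n0.
  by rewrite mulrA divff// mul1r mulrC.
rewrite c_0 mulr0; have NR : N = (complex.Re N)%:C by rewrite RRe_real// ger0_real.
have AR : a = (complex.Re a)%:C by rewrite RRe_real// ger0_real.
rewrite NR -[0]/((0:R)%:C) lecR leNgt; apply/negP => Np.
have := hr ((complex.Re a + 1) / (complex.Re N)); rewrite c_0 !mulr0 addr0.
rewrite NR {1}AR -!rmorphM -!rmorphB/= ler0c divfK ?gt_eqF//.
have : 0 <= complex.Re a by rewrite -ler0c -AR.
lra.
Qed.

Variable (Z : lmodType C) (q : Z -> Z -> C).
Implicit Types (u v w z : Z) (t : C).

Definition semi_inner := [/\ forall t u v w, q (t *: u + v) w = t * q u w + q v w,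
  forall t u v w, q w (t *: u + v) = (t^*)%R * q w u + q w v
  & forall u, 0 <= q u u].

Hypothesis qP : semi_inner.

Definition snorm u : C := sqrtC (q u u).

Lemma semi_innerPl t u v w : q (t *: u + v) w = t * q u w + q v w.
Proof. by case: qP. Qed.

Lemma semi_innerPr t u v w : q w (t *: u + v) = (t^*)%R * q w u + q w v.
Proof. by case: qP. Qed.

Lemma semi_inner_ge0 u : 0 <= q u u. Proof. by case: qP. Qed.

Lemma semi_inner_expand u t z :
  q (t *: z + u) (t *: z + u) =
  q u u + t * q z u + (t^*)%R * q u z + t * (t^*)%R * q z z.
Proof. by rewrite semi_innerPl !semi_innerPr; ring. Qed.

Lemma semi_inner_CS u v : `|q u v| ^+ 2 <= q u u * q v v /\ q v u = ((q u v)^*)%R.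
Proof.
have [|<- h] := @psd_quadratic (q v v) (q u v) (q v u) (q u u) (semi_inner_ge0 _).
  by move=> t; rewrite -semi_inner_expand semi_inner_ge0.
by rewrite mulrC.
Qed.

Lemma semi_innerC u v : q v u = ((q u v)^*)%R.
Proof. by have [] := semi_inner_CS u v. Qed.

Lemma snorm_ge0 u : 0 <= snorm u.
Proof. by rewrite sqrtC_ge0 semi_inner_ge0. Qed.

Lemma snormK u : snorm u ^+ 2 = q u u. Proof. exact: sqrtCK. Qed.

Lemma ler_snorm u (x : C) : 0 <= x -> q u u <= x ^+ 2 -> snorm u <= x.
Proof.
by move=> x0 h; rewrite -(ler_pXn2r (_ : 0 < 2)%N) ?nnegrE ?snorm_ge0// snormK.
Qed.

Lemma semi_inner_snorm u v : `|q u v| <= snorm u * snorm v.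
Proof.
rewrite -(ler_pXn2r (_ : 0 < 2)%N) ?nnegrE ?mulr_ge0 ?snorm_ge0//.
by rewrite exprMn !snormK; have [] := semi_inner_CS u v.
Qed.

Lemma semi_inner0l v : q 0 v = 0.
Proof.
have := semi_innerPl 1 0 0 v; rewrite scaler0 addr0 mul1r => /eqP.
by rewrite -subr_eq subrr eq_sym => /eqP.
Qed.

(** Projection without completeness: a bounded functional l is represented up to
e by any u that minimises q u u - 2 Re (l u) up to e ^ 2. *)
Lemma approx_riesz (l : {scalar Z}) (M : R) : 0 <= M ->
  (forall z, `|l z| <= M%:C * snorm z) ->
  forall e : R, 0 < e -> exists u, forall z, `|q z u - l z| <= e%:C * snorm z.
Proof.
move=> M0 lM e e0.
pose Q u : C := q u u - l u - ((l u)^*)%R.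
have QR u : Q u \is Num.real.
  rewrite /Q -addrA -opprD rpredB ?(ger0_real (semi_inner_ge0 _))//.
  by rewrite CrealE rmorphD/= conjCK addrC.
have Qge u : - (M%:C ^+ 2) <= Q u.
  have l1 : l u + ((l u)^*)%R <= 2 * (M%:C * snorm u).
    apply: le_trans (real_ler_norm _) _.
      by rewrite CrealE rmorphD/= conjCK addrC.
    rewrite (le_trans (ler_normD _ _))// norm_conjC -mulr2n mulr_natl.
    by rewrite lerMn2r lM.
  rewrite /Q -addrA -opprD -snormK lerBrDr.
  apply: le_trans (_ : - M%:C ^+ 2 + 2 * (M%:C * snorm u) <= _).
    by rewrite lerD2l.
  rewrite -subr_ge0 (_ : _ - _ = (snorm u - M%:C) ^+ 2); last by ring.
  by rewrite real_exprn_even_ge0// rpredB// ?ger0_real ?snorm_ge0// ler0c.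
pose S := range (fun u => complex.Re (Q u)).
have hS : has_inf S.
  split; first by exists (complex.Re (Q 0)), 0.
  exists (- M ^+ 2) => _ [u _ <-]; rewrite -lecR RRe_real//.
  by rewrite rmorphN rmorphXn.
have e2 : 0 < e ^+ 2 by rewrite exprn_gt0.
have [_ [u _ <-] hu] := inf_adherent e2 hS.
exists u => z; set d := q z u - l z.
rewrite -(ler_pXn2r (_ : 0 < 2)%N) ?nnegrE ?normr_ge0 ?mulr_ge0 ?snorm_ge0
  ?ler0c ?(ltW e0)//.
rewrite exprMn snormK.
have [||_ ->//] := @psd_quadratic (e%:C ^+ 2) d ((d^*)%R) (q z z).
  exact: semi_inner_ge0.
move=> t; have -> : e%:C ^+ 2 + t * d + (t^*)%R * (d^*)%R + t * (t^*)%R * q z z =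
    e%:C ^+ 2 + (Q (t *: z + u) - Q u).
  rewrite /Q semi_inner_expand linearP /= /d !rmorphB/= !rmorphD/= !rmorphM/=.
  by rewrite -semi_innerC; ring.
rewrite addrA subr_ge0 -(RRe_real (QR u)) -(RRe_real (QR (t *: z + u))).
rewrite -rmorphXn -rmorphD lecR.
have : inf S <= complex.Re (Q (t *: z + u)).
  by apply: ge_inf; [case: hS|exists (t *: z + u)].
move: hu; lra.
Qed.

End SemiInner.

(** * Schur products and limits of complex numbers *)

Section SemiInnerSums.
Variable R : realType.
Local Notation C := R[i].

Lemma semi_inner_suml (V : lmodType C) (f : V -> V -> C) (I : Type) (r : seq I)
  (c : I -> C) (v : I -> V) w : semi_inner f ->
  f (\sum_(i <- r) c i *: v i) w = \sum_(i <- r) c i * f (v i) w.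
Proof.
move=> fP; elim: r => [|i r ih]; first by rewrite !big_nil (semi_inner0l fP).
by rewrite !big_cons (semi_innerPl fP) ih.
Qed.

Lemma semi_inner_sumr (V : lmodType C) (f : V -> V -> C) (I : Type) (r : seq I)
  (c : I -> C) (v : I -> V) w : semi_inner f ->
  f w (\sum_(i <- r) c i *: v i) = \sum_(i <- r) (c i)^*%R * f w (v i).
Proof.
move=> fP; rewrite (semi_innerC fP) (semi_inner_suml _ _ _ _ fP) rmorph_sum.
by apply: eq_bigr => i _; rewrite rmorphM/= -(semi_innerC fP).
Qed.

(** Nonnegativity of the deflated form is the Cauchy-Schwarz inequality. *)
Lemma semi_inner_deflate (V : lmodType C) (f : V -> V -> C) x : semi_inner f ->
  semi_inner (fun u v => f u v - f u x * f x v / f x x).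
Proof.
move=> fP; split=> [t u v w|t u v w|u].
- by rewrite !(semi_innerPl fP); ring.
- by rewrite !(semi_innerPr fP); ring.
- have [-> |x0] := eqVneq (f x x) 0.
    by rewrite invr0 mulr0 subr0 (semi_inner_ge0 fP).
  have xp : 0 < f x x by rewrite lt_def x0 (semi_inner_ge0 fP).
  have [h1 h2] := semi_inner_CS fP u x.
  by rewrite subr_ge0 ler_pdivrMr// h2 -normCK.
Qed.

(** Schur's product theorem, stated for the Gram matrices of two families. Each
step subtracts from f a rank one form, whose product with g is nonnegative, and
makes one more of the vectors v i null. *)
Lemma schur_product (V W : lmodType C) (f : V -> V -> C) (g : W -> W -> C)
  (I : finType) (v : I -> V) (w : I -> W) : semi_inner f -> semi_inner g ->
  0 <= \sum_i \sum_j f (v i) (v j) * g (w i) (w j).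
Proof.
move=> + gP; have [n] := ubnP #|[pred i | f (v i) (v i) != 0]|.
elim: n f => // n ih f /ltnSE fn fP.
have [[k k0]|f0] := pselect (exists k, f (v k) (v k) != 0); last first.
  rewrite big1// => i _; rewrite big1// => j _.
  suff -> : f (v i) (v j) = 0 by rewrite mul0r.
  have [h _] := semi_inner_CS fP (v i) (v j).
  have ii : f (v i) (v i) = 0 by apply/eqP/negPn/negP => h'; apply: f0; exists i.
  move: h; rewrite ii mul0r => h; apply/eqP; rewrite -normr_eq0 -sqrf_eq0.
  by rewrite eq_le h exprn_ge0.
have a0 : 0 < f (v k) (v k) by rewrite lt_def k0 (semi_inner_ge0 fP).
pose f' x y := f x y - f x (v k) * f (v k) y / f (v k) (v k).
have f'P : semi_inner f' := semi_inner_deflate (v k) fP.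
have lt : (#|[pred i | f' (v i) (v i) != 0%R]| < n)%N.
  apply: leq_trans fn; apply: proper_card; apply/properP; split.
    apply/fintype.subsetP => i; rewrite !inE; apply: contra_neq => ii.
    have [h _] := semi_inner_CS fP (v i) (v k).
    have : f (v i) (v k) = 0.
      move: h; rewrite ii mul0r => h; apply/eqP; rewrite -normr_eq0 -sqrf_eq0.
      by rewrite eq_le h exprn_ge0.
    by rewrite /f' ii => ->; rewrite !mul0r subr0.
  by exists k; rewrite !inE ?k0// /f' mulfK// subrr eqxx.
have := ih _ lt f'P; pose c i := f (v i) (v k).
have := semi_inner_ge0 gP (\sum_i c i *: w i).
rewrite (semi_inner_suml _ _ _ _ gP) => h1 h2.
apply: le_trans (addr_ge0 h2 (divr_ge0 h1 (ltW a0))) _.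
rewrite mulr_suml -big_split/=; apply: ler_sum => i _.
rewrite (semi_inner_sumr _ _ _ _ gP) mulr_sumr mulr_suml -big_split/=.
apply: ler_sum => k' _; rewrite /f' /c -(semi_innerC fP).
by rewrite le_eqVlt; apply/orP; left; apply/eqP; ring.
Qed.

End SemiInnerSums.

Section ComplexLimits.
Variable R : realType.
Local Notation C := R[i].

(** The limit is the supremum of the left end points of the intervals with centre p.1
and radius p.2. *)
Lemma real_nested (S : set (R * R)) :
  (forall p p', S p -> S p' -> `|p.1 - p'.1| <= p.2 + p'.2) ->
  exists l, forall p, S p -> `|p.1 - l| <= p.2.
Proof.
move=> h; have [[p0 S0]|S0] := pselect (S !=set0); last first.
  by exists 0 => p Sp; exfalso; apply: S0; exists p.
pose A := [set p.1 - p.2 | p in S].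
have ub p : S p -> ubound A (p.1 + p.2).
  move=> Sp _ [p' Sp' <-]; have := h _ _ Sp' Sp.
  by move=> /(le_trans (ler_norm _)); lra.
have hs : has_sup A.
  by split; [exists (p0.1 - p0.2), p0|exists (p0.1 + p0.2); exact: ub].
exists (sup A) => p Sp; rewrite ler_distl; apply/andP; split.
  by rewrite lerBlDr; apply: ge_sup; [case: hs|apply: ub].
rewrite -lerBlDr; apply: ub_le_sup; [by case: hs|by exists p].
Qed.

Lemma norm_Re_le (z : C) : `|complex.Re z| <= complex.Re `|z|.
Proof.
rewrite -lecR RRe_real ?normr_real// normc_def /= lecR -sqrtr_sqr.
by rewrite ler_wsqrtr// lerDl sqr_ge0.
Qed.

Lemma norm_Im_le (z : C) : `|complex.Im z| <= complex.Re `|z|.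
Proof.
by rewrite normc_def /= -sqrtr_sqr ler_wsqrtr// lerDr sqr_ge0.
Qed.

Lemma norm_le_Re_Im (z : C) : `|z| <= `|complex.Re z|%:C + `|complex.Im z|%:C.
Proof.
rewrite {1}[z]complexE; apply: le_trans (ler_normD _ _) _.
rewrite normrM (_ : `|'i%C| = 1) ?mul1r; last by rewrite normCi.
by rewrite !normc_def /= !expr0n/= !addr0 !sqrtr_sqr.
Qed.

(** Cauchy completeness of C: the discs with centre p.1 and radius p.2 all contain, up to
a factor 2, a common point. *)
Lemma complex_nested (S : set (C * C)) :
  (forall p p', S p -> S p' -> `|p.1 - p'.1| <= p.2 + p'.2) ->
  exists l, forall p, S p -> `|p.1 - l| <= 2 * p.2.
Proof.
move=> h.
have r2 p : S p -> p.2 = (complex.Re p.2)%:C.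
  move=> Sp; rewrite RRe_real//.
  have := le_trans (normr_ge0 _) (h _ _ Sp Sp).
  by rewrite -mulr2n pmulrn_lge0// => /ger0_real.
have [|x hx] := @real_nested [set (complex.Re p.1, complex.Re p.2) | p in S].
  move=> _ _ [p Sp <-] [p' Sp' <-] /=; rewrite -raddfB -raddfD/=.
  apply: le_trans (norm_Re_le _) _; rewrite -lecR RRe_real ?normr_real//.
  by rewrite raddfD/= rmorphD/= -!r2//; exact: h.
have [|y hy] := @real_nested [set (complex.Im p.1, complex.Re p.2) | p in S].
  move=> _ _ [p Sp <-] [p' Sp' <-] /=; rewrite -raddfB -raddfD/=.
  apply: le_trans (norm_Im_le _) _; rewrite -lecR RRe_real ?normr_real//.
  by rewrite raddfD/= rmorphD/= -!r2//; exact: h.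
exists (x +i* y) => p Sp; apply: le_trans (norm_le_Re_Im _) _.
rewrite !raddfB/= -rmorphD/= (r2 _ Sp).
rewrite -[2](rmorph_nat (real_complex R) 2) -rmorphM lecR.
have := hx _ (ex_intro2 _ _ _ Sp erefl); have := hy _ (ex_intro2 _ _ _ Sp erefl).
by rewrite /=; lra.
Qed.

(** Equalities, bounds and positivity all pass to limits through this one statement. *)
Lemma ge0_of_approx (x K : C) :
  (forall e : C, 0 < e -> e <= 1 -> exists2 p : C, 0 <= p & `|x - p| <= K * e) ->
  0 <= x.
Proof.
move=> h; have K0 : 0 <= K.
  have [||p _] := h 1; [exact: ltr01|exact: lexx|].
  by rewrite mulr1; apply: le_trans.
have KR : K = (complex.Re K)%:C by rewrite RRe_real// ger0_real.
have {}h (e : R) : 0 < e -> e <= 1 ->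
    `|complex.Im x| <= complex.Re K * e /\ - (complex.Re K * e) <= complex.Re x.
  move=> e0 e1; have [||p p0 hp] := h e%:C.
  - by rewrite ltcR.
  - by rewrite lecR.
  have {}hp : complex.Re `|x - p| <= complex.Re K * e.
    by rewrite -lecR RRe_real ?normr_real// rmorphM/= -KR.
  split.
    have <- : complex.Im (x - p) = complex.Im x by rewrite raddfB/= (ger0_Im p0) subr0.
    exact: le_trans (norm_Im_le _) hp.
  have := le_trans (norm_Re_le _) hp; rewrite raddfB/= ler_norml => /andP[+ _].
  have : 0 <= complex.Re p by rewrite -lecR RRe_real// ger0_real.
  lra.
have small (y : R) : (forall e : R, 0 < e -> e <= 1 -> y <= complex.Re K * e) -> y <= 0.
  move=> hy; rewrite leNgt; apply/negP => y0.
  have K0' : 0 <= complex.Re K by rewrite -ler0c -KR.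
  have d0 : 0 < y + complex.Re K + 1 by lra.
  have := hy (y / (y + complex.Re K + 1)).
  rewrite divr_gt0// ler_pdivrMr// mul1r => /(_ erefl).
  have -> : y <= y + complex.Re K + 1 by lra.
  move=> /(_ erefl); rewrite mulrA ler_pdivlMr//; nra.
rewrite lecE /=; apply/andP; split.
  rewrite -normr_le0; apply: small => e e0 e1.
  by have [] := h e e0 e1.
rewrite -oppr_le0; apply: small => e e0 e1.
by have [_] := h e e0 e1; lra.
Qed.

Lemma eq_of_approx (x y K : C) :
  (forall e : C, 0 < e -> e <= 1 -> `|x - y| <= K * e) -> x = y.
Proof.
move=> h; apply/eqP; rewrite -subr_eq0 -normr_le0 -oppr_ge0.
apply: (@ge0_of_approx _ K) => e e0 e1; exists 0 => //.
by rewrite subr0 normrN normr_id h.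
Qed.

Lemma le_smallC (x M : C) : (forall e : R, 0 < e -> x <= e%:C * M) -> x <= 0.
Proof.
move=> h; rewrite -oppr_ge0; apply: (@ge0_of_approx _ `|M|) => e e0 _.
have eE : e = (complex.Re e)%:C by rewrite RRe_real// gtr0_real.
have e0' : 0 < complex.Re e by rewrite -ltcR -eE.
exists (e * M - x); first by rewrite subr_ge0 {1}eE h.
by rewrite opprB addKr normrN normrM (gtr0_norm e0) mulrC.
Qed.

End ComplexLimits.

(** * Operators on Hilbert spaces *)

Section HilbertSpace.
Variable R : realType.
Local Notation C := R[i].

Lemma hdot_semi_inner (H : preHilbertType R) :
  semi_inner (@hdot R H : H -> H -> C).
Proof.
split=> [t u v w|t u v w|u].
- by rewrite linearPl.
- by rewrite linearPr.
- by rewrite hdot_norm exprn_ge0.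
Qed.

Lemma snorm_hdot (H : preHilbertType R) (u : H) :
  snorm (@hdot R H : H -> H -> C) u = `|u|.
Proof. by rewrite /snorm hdot_norm sqrCK. Qed.

Lemma hdotC (H : preHilbertType R) (u v : H) : hdot v u = ((hdot u v)^*)%R.
Proof. exact: (semi_innerC (hdot_semi_inner H)). Qed.

Lemma hdot_suml (H : preHilbertType R) (I : finType) (u : I -> H) (v : H) :
  hdot (\sum_i u i) v = \sum_i hdot (u i) v.
Proof.
by apply: (big_morph (fun x => hdot x v) (linearDl hdot v)); rewrite linear0l.
Qed.

Lemma hdot_CS (H : preHilbertType R) (u v : H) : `|hdot u v| <= `|u| * `|v|.
Proof.
by rewrite -!snorm_hdot; exact: (semi_inner_snorm (hdot_semi_inner H)).
Qed.

Lemma hdot_inj (H : preHilbertType R) (u v : H) :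
  (forall z, hdot u z = hdot v z) -> u = v.
Proof.
move=> h; apply/eqP; rewrite -subr_eq0 -normr_eq0 -sqrf_eq0 -hdot_norm.
by rewrite {1}linearBl /= h subrr.
Qed.

(** Approximate representatives at scale 1 / n form a Cauchy sequence, because the
difference of two of them is tested against itself. *)
Lemma riesz (H : hilbertType R) (l : {scalar H}) (M : R) : 0 <= M ->
  (forall z, `|l z| <= M%:C * `|z|) -> exists u, forall z, hdot z u = l z.
Proof.
move=> M0 lM.
have lM' z : `|l z| <= M%:C * snorm (@hdot R H : H -> H -> C) z by rewrite snorm_hdot.
have ap (n : nat) : exists u : H, forall z, `|hdot z u - l z| <= (n.+1%:R^-1)%:C * `|z|.
  have [|u hu] := approx_riesz (hdot_semi_inner H) M0 lM' (_ : 0 < n.+1%:R^-1).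
    by rewrite invr_gt0.
  by exists u => z; rewrite -snorm_hdot.
have [u hu] := choice ap.
have du m n : `|u m - u n| <= (m.+1%:R^-1 + n.+1%:R^-1)%:C.
  set z := u m - u n.
  have [->|z0] := eqVneq z 0; first by rewrite normr0 ler0c addr_ge0// invr_ge0.
  rewrite -(ler_pM2r (_ : 0 < `|z|)) ?normr_gt0// -expr2 -hdot_norm.
  rewrite -[leLHS]ger0_norm; last by rewrite hdot_norm exprn_ge0.
  have -> : hdot z z = (hdot z (u m) - l z) - (hdot z (u n) - l z).
    by rewrite {2}/z linearBr /= opprB addrA subrK.
  by rewrite rmorphD mulrDl (le_trans (ler_normB _ _))// lerD.
have : cvg (u @ \oo).
  apply: cauchy_cvg; apply: cauchy_exP => e e0.
  have eE : e = (complex.Re e)%:C by rewrite RRe_real// gtr0_real.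
  have e0' : 0 < complex.Re e by rewrite -ltcR -eE.
  have [N _ hN] := near_infty_natSinv_lt (PosNum (divr_gt0 e0' (ltr0Sn R 1))).
  exists (u N); exists N => // n /= Nn; rewrite -ball_normE /=.
  apply: le_lt_trans (du _ _) _; rewrite eE ltcR.
  have := hN N (leqnn _); have := hN n Nn; rewrite /= => h1 h2.
  by rewrite (splitr (complex.Re e)) ltrD.
move=> /cvg_ex[/= v uv]; exists v => z.
apply/eqP; rewrite -subr_eq0 -normr_le0; apply: (@le_smallC _ _ (2 * `|z|)) => e e0.
have e0' : (0 : C) < e%:C by rewrite ltcR.
move/cvgrPdist_lt: uv => /(_ _ e0')[N1 _ hN1].
have [N2 _ hN2] := near_infty_natSinv_lt (PosNum e0).
pose n := maxn N1 N2.
have h1 := ltW (hN1 n (leq_maxl _ _)); have h2 := ltW (hN2 n (leq_maxr _ _)).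
have -> : hdot z v - l z = hdot z (v - u n) + (hdot z (u n) - l z).
  by rewrite linearBr /= addrA subrK.
apply: le_trans (ler_normD _ _) _.
rewrite (_ : e%:C * _ = `|z| * e%:C + e%:C * `|z|); last by ring.
apply: lerD.
  by apply: le_trans (hdot_CS _ _) _; rewrite ler_wpM2l.
by apply: le_trans (hu n z) _; rewrite ler_wpM2r// lecR.
Qed.

Lemma bop_linear (V W : normedModType C) (T : bop V W) : linear T.
Proof. by have /asboolP[] := bop_funP T. Qed.

Lemma bop0 (V W : normedModType C) (T : bop V W) : T 0 = 0.
Proof.
have := bop_linear T 1 0 0; rewrite scaler0 addr0 scale1r => /eqP.
by rewrite -subr_eq subrr eq_sym => /eqP.
Qed.

Lemma bopZ (V W : normedModType C) (T : bop V W) t v : T (t *: v) = t *: T v.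
Proof. by have := bop_linear T t v 0; rewrite bop0 !addr0. Qed.

Lemma bop_inj (V W : normedModType C) (S T : bop V W) :
  (forall v, S v = T v) -> S = T.
Proof. by move=> h; apply/val_inj/funext. Qed.

Lemma bop_of_form (V : normedModType C) (K : hilbertType R)
  (F : V -> K -> C) (M : C) : 0 <= M ->
  (forall t u v w, F (t *: u + v) w = t * F u w + F v w) ->
  (forall t u v w, F w (t *: u + v) = (t^*)%R * F w u + F w v) ->
  (forall u v, `|F u v| <= M * `|u| * `|v|) ->
  exists T : bop V K, forall u v, hdot (T u) v = F u v.
Proof.
move=> M0 Fl Fr FM.
have /choice[T TF] u : exists x, forall v, hdot x v = F u v.
  pose l v := ((F u v)^*)%R.
  have ll : scalar l by move=> t v w; rewrite /l Fr rmorphD rmorphM/= conjCK.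
  pose l' : {scalar K} := HB.pack l (GRing.isLinear.Build _ _ _ _ l ll).
  have [||x hx] := @riesz K l' (complex.Re (M * `|u|)).
  - by rewrite -ler0c RRe_real ?mulr_ge0// ger0_real// mulr_ge0.
  - by move=> v; rewrite RRe_real ?ger0_real ?mulr_ge0// norm_conjC.
  by exists x => v; rewrite hdotC hx /= /l conjCK.
have Tb : T \in @bounded_linear C V K.
  apply/asboolP; split.
    move=> t u v; apply: hdot_inj => w; rewrite linearPl /= !TF; exact: Fl.
  exists M => v; have [->|Tv0] := eqVneq (T v) 0.
    by rewrite normr0 mulr_ge0.
  rewrite -(ler_pM2r (_ : 0 < `|T v|)) ?normr_gt0// -expr2 -hdot_norm TF.
  apply: le_trans (FM _ _); apply: real_ler_norm.
  by rewrite -TF hdot_norm rpredX// normr_real.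
by exists (Bop Tb).
Qed.

Lemma adj_exists (H : hilbertType R) (K : preHilbertType R) (T : bop H K) :
  exists S : bop K H, is_adjoint T S.
Proof.
have /asboolP[Tl [M TM]] := bop_funP T.
have [||||S hS] := @bop_of_form K H (fun k h => hdot k (T h)) `|M|.
- exact: normr_ge0.
- by move=> t u v w; rewrite linearPl.
- by move=> t u v w; rewrite Tl linearPr.
- move=> u v; apply: le_trans (hdot_CS _ _) _; rewrite mulrC mulrAC ler_wpM2r//.
  apply: le_trans (TM _) _; rewrite -[`|v|]normr_id -normrM.
  by rewrite normr_id ger0_norm ?lexx// (le_trans _ (TM v)).
by exists S => h k; rewrite hdotC -hS -hdotC.
Qed.

(** For operators defined on the scalars the adjoint is explicit. *)
Lemma adj_exists_line (H : preHilbertType R) (T : bop R[i]^o H) :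
  exists S : bop H R[i]^o, is_adjoint T S.
Proof.
pose S (h : H) : C^o := hdot h (T 1).
have Sb : S \in @bounded_linear C H C^o.
  apply/asboolP; split; first by move=> t u v; rewrite /S linearPl.
  by exists `|T 1| => v; rewrite mulrC; exact: hdot_CS.
exists (Bop Sb) => c h /=.
have -> : T c = c *: T 1 by rewrite -bopZ [_ *: _](mulr1 c).
by rewrite linearZl_LR /= hdotC.
Qed.

Lemma adjP (H K : preHilbertType R) (T : bop H K) :
  (exists S : bop K H, is_adjoint T S) -> is_adjoint T (adj T).
Proof.
move=> [S TS]; rewrite /adj; case: xgetP => [S' _ //|].
by move=> /(_ S).
Qed.

End HilbertSpace.

(** * Compression of the GNS representation *)

Section Dilation.
Variables (R : realType) (B : cstarType R) (s : {scalar B}).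
Local Notation C := R[i].

Hypothesis sP : is_state s.

Lemma state_pos b : 0 <= s (star b * b).
Proof. by case: sP => h _; exact: h. Qed.

Definition gns (u v : B) : C := s (star v * u).

Lemma gns_semi_inner : semi_inner gns.
Proof.
split=> [t u v w|t u v w|u].
- by rewrite /gns mulrDr -scalerAr linearP.
- by rewrite /gns raddfD/= starZ mulrDl -scalerAl linearP.
- exact: state_pos.
Qed.

Lemma state_star b : s (star b) = ((s b)^*)%R.
Proof.
have := semi_innerC gns_semi_inner b 1.
by rewrite /gns star1 mul1r mulr1.
Qed.

Lemma state_norm_sqr b : `|s b| ^+ 2 <= s (b * star b).
Proof.
have [h _] := semi_inner_CS gns_semi_inner 1 (star b).
by move: h; rewrite /gns starK star1 !mulr1; case: sP => _ ->; rewrite mul1r.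
Qed.

(** Left multiplication by b is bounded by the norm of b because
|b|^2 - star b * b is a square k * k. *)
Lemma gns_mul_bound b u v : `|s (star v * b * u)| <=
  (cnorm b)%:C * snorm gns u * snorm gns v.
Proof.
rewrite -mulrA; apply: le_trans (semi_inner_snorm gns_semi_inner (b * u) v) _.
rewrite ler_wpM2r ?(snorm_ge0 gns_semi_inner)//.
apply: (ler_snorm gns_semi_inner).
  by rewrite mulr_ge0 ?(snorm_ge0 gns_semi_inner)// ler0c cnorm_ge0.
rewrite exprMn snormK -subr_ge0 /gns.
have pz : cpos ((cnorm b ^+ 2)%:C%:A - star b * b).
  by apply: cpos_norm_sub; rewrite ?starM ?starK// cnorm_star.
have [k [[sk _] kk _]] := cpos_sqrt pz.
have -> : (cnorm b)%:C ^+ 2 * s (star u * u) - s (star (b * u) * (b * u)) =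
    s (star (k * u) * (k * u)).
  rewrite !starM sk -!mulrA (mulrA k) kk mulrBl mulrBr raddfB/=.
  by rewrite -scalerAl mul1r -scalerAr linearZ/= rmorphXn -!mulrA.
exact: state_pos.
Qed.

Variables (Z : lmodType C) (j : {linear Z -> B}).
Variables (H : hilbertType R) (xi : {linear Z -> H}).
Hypothesis xi_le : forall z, `|xi z| ^+ 2 <= s (star (j z) * j z).
Implicit Types (u v z : Z) (h k : H) (b : B) (e : C).

Let q u v := gns (j u) (j v).

Let qP : semi_inner q.
Proof.
have [gl gr g0] := gns_semi_inner.
by split=> [t u v w|t u v w|u]; rewrite /q ?linearP.
Qed.

Let n u := snorm q u.

Let n_ge0 u : 0 <= n u. Proof. exact: (snorm_ge0 qP). Qed.

(** Here z stands for the vector of j z in the GNS space of s, and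
[represents h e u] says that u is within e of the image of h under the adjoint
of the contraction taking the vector of j z to xi z. *)
Definition represents h e u :=
  forall z, `|q z u - hdot (xi z) h| <= e * n z.

(** Cauchy-Schwarz in H and the domination of xi by s bound z |-> <xi z, h> by
|h| times the GNS norm of z. *)
Lemma represents_exists h e : 0 < e -> exists u, represents h e u.
Proof.
move=> e0; pose l z := hdot (xi z) h.
have ll : scalar l by move=> t z w; rewrite /l linearP linearPl.
pose l' : {scalar Z} := HB.pack l (GRing.isLinear.Build _ _ _ _ l ll).
have xin z : `|xi z| <= n z.
  rewrite -(ler_pXn2r (_ : 0 < 2)%N) ?nnegrE ?normr_ge0//.
  by rewrite snormK; exact: xi_le.
have hE : `|h| = (complex.Re `|h|)%:C by rewrite RRe_real// normr_real.
have eE : e = (complex.Re e)%:C by rewrite RRe_real// gtr0_real.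
have [|||u hu] := @approx_riesz R Z q qP l' (complex.Re `|h|) _ _ (complex.Re e).
- by rewrite -ler0c -hE.
- move=> z; rewrite -hE; apply: le_trans (hdot_CS _ _) _.
  by rewrite mulrC ler_wpM2l.
- by rewrite -ltcR -eE.
by exists u => z; have := hu z; rewrite -eE.
Qed.

Lemma represents_le h e e' u : e <= e' -> represents h e u -> represents h e' u.
Proof.
by move=> ee' hu z; apply: le_trans (hu z) _; rewrite ler_wpM2r.
Qed.

Let n_le u (x : C) : 0 <= x -> q u u <= x * n u -> n u <= x.
Proof.
move=> x0; have [->|u0] := eqVneq (n u) 0; first by [].
by rewrite -(snormK q) expr2 -/(n u) ler_pM2r// lt_def u0 n_ge0.
Qed.

Lemma represents_norm h e u : 0 < e -> represents h e u -> n u <= `|h| + e.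
Proof.
move=> e0 hu; apply: n_le; first by rewrite addr_ge0// ltW.
rewrite mulrDl -[leLHS](ger0_norm (semi_inner_ge0 qP u)).
rewrite -[q u u](subrK (hdot (xi u) h)) addrC.
apply: le_trans (ler_normD _ _) _; apply: lerD (hu u).
apply: le_trans (hdot_CS _ _) _; rewrite mulrC ler_wpM2l//.
rewrite -(ler_pXn2r (_ : 0 < 2)%N) ?nnegrE ?normr_ge0//.
by rewrite snormK; exact: xi_le.
Qed.

Lemma represents_dist h e e' u u' : 0 < e -> 0 < e' ->
  represents h e u -> represents h e' u' -> n (u - u') <= e + e'.
Proof.
move=> e0 e0' hu hu'; apply: n_le; first by rewrite addr_ge0// ltW.
have E z : q z (u - u') = (q z u - hdot (xi z) h) - (q z u' - hdot (xi z) h).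
  rewrite -[- u']scaleN1r addrC (semi_innerPr qP) rmorphN1 mulN1r.
  by rewrite opprB addrA subrK addrC.
rewrite -[leLHS](ger0_norm (semi_inner_ge0 qP _)) E mulrDl.
by apply: le_trans (ler_normB _ _) _; apply: lerD.
Qed.

Lemma represents_linear t h k e e' u v : represents h e u ->
  represents k e' v -> represents (t *: h + k) (`|t| * e + e') (t *: u + v).
Proof.
move=> hu hv z; rewrite (semi_innerPr qP) linearPr /=.
have -> : (t^*)%R * q z u + q z v - ((t^*)%R * hdot (xi z) h + hdot (xi z) k) =
  (t^*)%R * (q z u - hdot (xi z) h) + (q z v - hdot (xi z) k) by ring.
rewrite mulrDl; apply: le_trans (ler_normD _ _) _; apply: lerD (hv z).
by rewrite normrM norm_conjC -mulrA ler_wpM2l.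
Qed.

Let W b u v : C := s (star (j v) * b * j u).

Let WP b u v : `|W b u v| <= (cnorm b)%:C * n u * n v.
Proof. exact: gns_mul_bound. Qed.

Let Wl b t u v w : W b (t *: u + v) w = t * W b u w + W b v w.
Proof. by rewrite /W !linearP /= mulrDr -scalerAr linearP. Qed.

Let WC b u v : W (star b) v u = ((W b u v)^*)%R.
Proof. by rewrite -state_star /W !starM starK mulrA. Qed.

Let Wb b b' t u v : W (t *: b + b') u v = t * W b u v + W b' u v.
Proof. by rewrite /W mulrDr mulrDl -scalerAr -scalerAl linearP. Qed.

Let radius b h k : C := (cnorm b)%:C * (`|h| + `|k| + 2).

Let radius_ge0 b h k : 0 <= radius b h k.
Proof. by rewrite mulr_ge0 ?addr_ge0// ler0c cnorm_ge0. Qed.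

(** The values s (star (j v) * b * j u) form a Cauchy family: they are sesquilinear and
bounded in u and v, and representatives at scales e and e' are e + e' apart. *)
Lemma compression_exists b h k : exists l : C, forall e u v, 0 < e -> e <= 1 ->
  represents h e u -> represents k e v -> `|W b u v - l| <= 2 * radius b h k * e.
Proof.
have [|l hl] := @complex_nested R [set p | exists e u v, [/\ 0 < e, e <= 1,
   represents h e u, represents k e v & p = (W b u v, radius b h k * e)]].
  move=> _ _ [e [u [v [e0 e1 hu hv ->]]]] [e' [u' [v' [e0' e1' hu' hv' ->]]]] /=.
  have -> : W b u v - W b u' v' = W b (u - u') v + ((W (star b) (v - v') u')^*)%R.
    by rewrite -WC starK /W !raddfB/= !(mulrBl, mulrBr) !raddfB/=; ring.
  apply: le_trans (ler_normD _ _) _; rewrite norm_conjC.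
  apply: le_trans (lerD (WP _ _ _) (WP _ _ _)) _.
  rewrite cnorm_starE /radius -!mulrA -!mulrDr ler_wpM2l ?ler0c ?cnorm_ge0//.
  have d1 := represents_dist e0 e0' hu hu'; have d2 := represents_dist e0 e0' hv hv'.
  have m1 : n v <= `|k| + 1.
    by apply: le_trans (represents_norm e0 hv) _; rewrite lerD2l.
  have m2 : n u' <= `|h| + 1.
    by apply: le_trans (represents_norm e0' hu') _; rewrite lerD2l.
  apply: le_trans (lerD (ler_pM _ _ d1 m1) (ler_pM _ _ d2 m2)) _ => //.
  by rewrite le_eqVlt; apply/orP; left; apply/eqP; ring.
exists l => e u v e0 e1 hu hv.
by rewrite -mulrA; apply: (hl (_, _)); exists e, u, v.
Qed.

(** The sesquilinear form of T pi(b) T', where T takes the GNS vector of j z to xi z. *)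
Definition compression b h k : C := projT1 (cid (compression_exists b h k)).

Lemma compressionP b h k e u v : 0 < e -> e <= 1 ->
  represents h e u -> represents k e v ->
  `|compression b h k - W b u v| <= 2 * radius b h k * e.
Proof.
by rewrite distrC /compression; case: cid => l /= hl; exact: hl.
Qed.

Lemma compression_linear b h h' k t : compression b (t *: h + h') k =
  t * compression b h k + compression b h' k.
Proof.
have c0 : 0 < `|t| + 1 :> C by rewrite ltr_wpDl.
set r1 := 2 * radius b (t *: h + h') k.
set r2 := 2 * radius b h k; set r3 := 2 * radius b h' k.
have r20 : 0 <= r2 by rewrite mulr_ge0.
have r30 : 0 <= r3 by rewrite mulr_ge0.
apply: (@eq_of_approx _ _ _ (r1 + (`|t| * r2 + r3))) => e e0 e1.
pose d := e / (`|t| + 1).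
have d0 : 0 < d by rewrite divr_gt0.
have de : d <= e by rewrite ler_pdivrMr// ler_peMr// ?lerDr ?(ltW e0).
have d1 : d <= 1 := le_trans de e1.
have [u hu] := represents_exists h d0; have [u' hu'] := represents_exists h' d0.
have [v hv] := represents_exists k d0.
have huu : represents (t *: h + h') e (t *: u + u').
  apply: represents_le (represents_linear t hu hu').
  by rewrite -[X in _ + X]mul1r -mulrDl mulrC divfK ?gt_eqF.
have E1 := compressionP b e0 e1 huu (represents_le de hv).
have E2 := compressionP b d0 d1 hu hv; have E3 := compressionP b d0 d1 hu' hv.
have -> : compression b (t *: h + h') k - (t * compression b h k + compression b h' k)
  = (compression b (t *: h + h') k - W b (t *: u + u') v)
    - (t * (compression b h k - W b u v) + (compression b h' k - W b u' v)).
  by rewrite Wl; ring.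
apply: le_trans (ler_normB _ _) _; rewrite mulrDl; apply: lerD E1 _.
apply: le_trans (ler_normD _ _) _; rewrite mulrDl; apply: lerD.
  rewrite normrM -mulrA ler_wpM2l//; apply: le_trans E2 _.
  by rewrite ler_wpM2l.
by apply: le_trans E3 _; rewrite ler_wpM2l.
Qed.

Lemma compressionC b h k : compression (star b) k h = ((compression b h k)^*)%R.
Proof.
apply: (@eq_of_approx _ _ _ (2 * radius (star b) k h + 2 * radius b h k)) => e e0 e1.
have [u hu] := represents_exists h e0; have [v hv] := represents_exists k e0.
have E1 := compressionP b e0 e1 hu hv; have E2 := compressionP (star b) e0 e1 hv hu.
have -> : compression (star b) k h - ((compression b h k)^*)%R =
  (compression (star b) k h - W (star b) v u)
    - ((compression b h k - W b u v)^*)%R by rewrite rmorphB/= -WC; ring.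
rewrite mulrDl; apply: le_trans (ler_normB _ _) _; apply: lerD => //.
by rewrite norm_conjC.
Qed.

Lemma compression_linear_alg b b' h k t : compression (t *: b + b') h k =
  t * compression b h k + compression b' h k.
Proof.
apply: (@eq_of_approx _ _ _ (2 * radius (t *: b + b') h k
  + (`|t| * (2 * radius b h k) + 2 * radius b' h k))) => e e0 e1.
have [u hu] := represents_exists h e0; have [v hv] := represents_exists k e0.
have E1 := compressionP (t *: b + b') e0 e1 hu hv.
have E2 := compressionP b e0 e1 hu hv; have E3 := compressionP b' e0 e1 hu hv.
have -> : compression (t *: b + b') h k - (t * compression b h k + compression b' h k)
  = (compression (t *: b + b') h k - W (t *: b + b') u v)
    - (t * (compression b h k - W b u v) + (compression b' h k - W b' u v)).
  by rewrite Wb; ring.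
apply: le_trans (ler_normB _ _) _; rewrite mulrDl; apply: lerD E1 _.
apply: le_trans (ler_normD _ _) _; rewrite mulrDl; apply: lerD E3.
by rewrite normrM -mulrA ler_wpM2l.
Qed.

Lemma compression_bound b h k :
  `|compression b h k| <= (cnorm b)%:C * `|h| * `|k|.
Proof.
have b0 : 0 <= (cnorm b)%:C :> C by rewrite ler0c cnorm_ge0.
rewrite -subr_ge0; set x := compression b h k.
apply: (@ge0_of_approx _ _ ((cnorm b)%:C * (`|h| + `|k| + 1) + 2 * radius b h k)).
move=> e e0 e1.
have [u hu] := represents_exists h e0; have [v hv] := represents_exists k e0.
exists ((cnorm b)%:C * (`|h| + e) * (`|k| + e) - `|W b u v|).
  rewrite subr_ge0; apply: le_trans (WP _ _ _) _.
  by rewrite -!mulrA ler_wpM2l// ler_pM// (represents_norm e0).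
have -> : (cnorm b)%:C * `|h| * `|k| - `|x| -
  ((cnorm b)%:C * (`|h| + e) * (`|k| + e) - `|W b u v|) =
  - ((cnorm b)%:C * (`|h| + `|k| + e) * e) + (`|W b u v| - `|x|) by ring.
apply: le_trans (ler_normD _ _) _; rewrite [leRHS]mulrDl normrN; apply: lerD.
  have e0' := ltW e0.
  rewrite ger0_norm ?mulr_ge0 ?addr_ge0// ler_wpM2r// ler_wpM2l// lerD2l//.
apply: le_trans (ler_dist_dist _ _) _.
by rewrite distrC; exact: compressionP.
Qed.

Lemma compression_contractive h : compression 1 h h <= hdot h h.
Proof.
rewrite -subr_ge0.
apply: (@ge0_of_approx _ _ (2 * `|h| + 1 + 2 * radius 1 h h)) => e e0 e1.
have [u hu] := represents_exists h e0.
exists ((`|h| + e) ^+ 2 - W 1 u u).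
  rewrite subr_ge0 /W mulr1 -[leLHS](snormK q u).
  rewrite ler_pXn2r ?nnegrE ?n_ge0 ?addr_ge0 ?(ltW e0)//.
  exact: represents_norm.
have -> : hdot h h - compression 1 h h - ((`|h| + e) ^+ 2 - W 1 u u) =
  - ((2 * `|h| + e) * e) - (compression 1 h h - W 1 u u).
  by rewrite hdot_norm; ring.
apply: le_trans (ler_normB _ _) _; rewrite [leRHS]mulrDl normrN; apply: lerD.
  have e0' := ltW e0.
  by rewrite ger0_norm ?mulr_ge0 ?addr_ge0 ?mulr_ge0// ler_wpM2r// lerD2l.
exact: compressionP.
Qed.

(** At each scale the double sum is s (star y * y), for y the sum of the
d k * j (u k). *)
Lemma compression_cp m (d : 'I_m -> B) (h : 'I_m -> H) :
  0 <= \sum_i \sum_k compression (star (d i) * d k) (h k) (h i).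
Proof.
apply: (@ge0_of_approx _ _
  (\sum_i \sum_k 2 * radius (star (d i) * d k) (h k) (h i))) => e e0 e1.
have [u hu] := choice (fun i => represents_exists (h i) e0).
exists (\sum_i \sum_k W (star (d i) * d k) (u k) (u i)).
  rewrite (_ : \sum_i _ = s (star (\sum_k d k * j (u k)) * (\sum_k d k * j (u k)))).
    exact: state_pos.
  rewrite raddf_sum mulr_suml raddf_sum; apply: eq_bigr => i _ /=.
  rewrite mulr_sumr raddf_sum; apply: eq_bigr => k _ /=.
  by rewrite /W starM !mulrA.
rewrite -sumrB mulr_suml; apply: le_trans (ler_norm_sum _ _ _) _.
apply: ler_sum => i _; rewrite -sumrB mulr_suml.
apply: le_trans (ler_norm_sum _ _ _) _; apply: ler_sum => k _.
exact: compressionP.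
Qed.

(** In the limit u represents T' h, and <xi z, h> = s (star (j u) * j z) is controlled
by |s x|^2 <= s (x * star x). *)
Lemma compression_dominates z h :
  `|hdot (xi z) h| ^+ 2 <= compression (j z * star (j z)) h h.
Proof.
rewrite -subr_ge0; set b := j z * star (j z); set l := hdot (xi z) h.
apply: (@ge0_of_approx _ _ (2 * radius b h h + n z * (2 * `|l| + n z))) => e e0 e1.
have [u hu] := represents_exists h e0.
exists (W b u u - `|q z u| ^+ 2).
  rewrite subr_ge0; apply: le_trans (state_norm_sqr _) _.
  by rewrite starM starK /W !mulrA.
have -> : compression b h h - `|l| ^+ 2 - (W b u u - `|q z u| ^+ 2) =
  (compression b h h - W b u u) + (`|q z u| - `|l|) * (`|q z u| + `|l|) by ring.
apply: le_trans (ler_normD _ _) _; rewrite [leRHS]mulrDl; apply: lerD.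
  exact: compressionP.
rewrite normrM.
have d1 : `| `|q z u| - `|l| | <= e * n z by apply: le_trans (ler_dist_dist _ _) (hu z).
rewrite mulrAC [n z * e]mulrC; apply: ler_pM => //.
rewrite ger0_norm ?addr_ge0// mulr_natl mulr2n addrAC lerD2r addrC.
rewrite -lerBlDr (le_trans (real_ler_norm _))//.
  by apply: le_trans d1 _; rewrite ler_piMl.
Qed.

End Dilation.

(** * The dominating unital completely positive map *)

Section Dominating.
Variables (R : realType) (B : cstarType R) (s : {scalar B}).
Local Notation C := R[i].
Hypothesis sP : is_state s.
Variables (Z : lmodType C) (j : {linear Z -> B}).
Variables (H : hilbertType R) (xi : {linear Z -> H}).
Hypothesis xi_le : forall z, `|xi z| ^+ 2 <= s (star (j z) * j z).
Implicit Types (b : B) (h k : H).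

Local Notation compr := (compression sP xi_le).

Let defect h k : C := hdot h k - compr 1 h k.

(** The defect is the form of 1 - T T'. *)
Let defectP : semi_inner defect.
Proof.
have [dl dr _] := hdot_semi_inner H.
split=> [t u v w|t u v w|u]; last by rewrite subr_ge0 compression_contractive.
- by rewrite /defect dl compression_linear; ring.
- rewrite /defect dr -[1]star1 !(compressionC sP xi_le _ _ w) compression_linear.
  by rewrite rmorphD rmorphM/=; ring.
Qed.

(** The term weighted by the state makes the map unital. *)
Definition unital_form b h k : C := compr b h k + s b * defect h k.

Lemma unital_form_linear b h h' k t :
  unital_form b (t *: h + h') k = t * unital_form b h k + unital_form b h' k.
Proof.
by rewrite /unital_form compression_linear (semi_innerPl defectP); ring.
Qed.

Lemma unital_form_linearr b h k k' t : unital_form b h (t *: k + k') =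
  (t^*)%R * unital_form b h k + unital_form b h k'.
Proof.
rewrite /unital_form (semi_innerPr defectP) -(starK b) !(compressionC sP xi_le _ _ h).
by rewrite compression_linear rmorphD rmorphM/=; ring.
Qed.

Lemma unital_form_linear_alg a b h k t : unital_form (t *: a + b) h k =
  t * unital_form a h k + unital_form b h k.
Proof. by rewrite /unital_form compression_linear_alg linearP /=; ring. Qed.

Lemma unital_form_sum (I : finType) (b : I -> B) h k :
  unital_form (\sum_i b i) h k = \sum_i unital_form (b i) h k.
Proof.
have D a c : unital_form (a + c) h k = unital_form a h k + unital_form c h k.
  by rewrite -{1}[a]scale1r unital_form_linear_alg mul1r.
apply: (big_morph (fun b => unital_form b h k) D).
by apply: (addIr (unital_form 0 h k)); rewrite -D !add0r.
Qed.

Lemma unital_form_bound b h k : `|unital_form b h k| <=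
  ((cnorm b)%:C + `|s b| * (1 + (cnorm (1 : B))%:C)) * `|h| * `|k|.
Proof.
apply: le_trans (ler_normD _ _) _; rewrite !mulrDl lerD ?compression_bound//.
rewrite normrM -!mulrA ler_wpM2l// !mulrDl mul1r.
apply: le_trans (ler_normB _ _) _; rewrite lerD ?hdot_CS// mulrA.
exact: compression_bound.
Qed.

Lemma unital_operator b : exists T : bop H H, forall h k,
  hdot (T h) k = unital_form b h k.
Proof.
apply: bop_of_form (unital_form_bound b) => [||].
- by rewrite addr_ge0 ?mulr_ge0 ?addr_ge0// ler0c cnorm_ge0.
- by move=> *; exact: unital_form_linear.
- by move=> *; exact: unital_form_linearr.
Qed.

Theorem dominating_ucp : exists Phi : {linear B -> bop H H},
  is_ucp Phi /\ forall z h,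
    `|hdot (xi z) h| ^+ 2 <= hdot (Phi (j z * star (j z)) h) h.
Proof.
have /choice[phi phiE] := unital_operator.
have phil : linear phi.
  move=> t a b; apply: bop_inj => h; apply: hdot_inj => k.
  rewrite phiE -[RHS]/(hdot (t *: phi a h + phi b h) k).
  by rewrite linearPl /= !phiE unital_form_linear_alg.
pose Phi : {linear B -> bop H H} :=
  HB.pack phi (GRing.isLinear.Build _ _ _ _ phi phil).
have PhiE b h k : hdot (Phi b h) k = unital_form b h k by exact: phiE.
exists Phi; split; first split.
- move=> m D h; rewrite /dsum_dot.
  have E i : hdot (mxop_apply (map_mx Phi (mxstar D *m D)) h i) (h i) =
    \sum_l \sum_k unital_form (star (D l i) * D l k) (h k) (h i).
    rewrite exchange_big /mxop_apply /= hdot_suml.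
    apply: eq_bigr => k _; rewrite !mxE PhiE unital_form_sum.
    by apply: eq_bigr => l _; rewrite !mxE.
  under eq_bigr do rewrite E.
  rewrite exchange_big; apply: sumr_ge0 => l _ /=.
  under eq_bigr do rewrite big_split /=.
  rewrite big_split addr_ge0//; first exact: compression_cp.
  have := schur_product (fun i => D l i) h (gns_semi_inner sP) defectP.
  by rewrite exchange_big.
- apply: bop_inj => h; apply: hdot_inj => k.
  by rewrite PhiE /unital_form (proj2 sP) mul1r addrC subrK.
- move=> z h; rewrite PhiE; apply: le_trans (compression_dominates sP xi_le z h) _.
  rewrite /unital_form lerDl mulr_ge0 ?(semi_inner_ge0 defectP)//.
  by have := state_pos sP (star (j z)); rewrite starK.
Qed.

End Dominating.

(** * Norms of operator matrices *)

Section MatrixNorms.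
Variable R : realType.
Local Notation C := R[i].

Lemma dsum_norm_sqr (H : preHilbertType R) n (h : 'I_n -> H) :
  dsum_norm h ^+ 2 = \sum_i `|h i| ^+ 2.
Proof. exact: sqrtCK. Qed.

Lemma dsum_norm_ge0 (H : preHilbertType R) n (h : 'I_n -> H) : 0 <= dsum_norm h.
Proof. by rewrite sqrtC_ge0 sumr_ge0// => i _; rewrite exprn_ge0. Qed.

Lemma dsum_norm_le (H K : preHilbertType R) m n (h : 'I_m -> H) (k : 'I_n -> K)
  (r : R) : 0 <= r ->
  (dsum_norm h <= r%:C * dsum_norm k) =
  (\sum_i `|h i| ^+ 2 <= r%:C ^+ 2 * \sum_i `|k i| ^+ 2).
Proof.
move=> r0; rewrite -!dsum_norm_sqr -exprMn ler_pXn2r// nnegrE ?dsum_norm_ge0//.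
by rewrite mulr_ge0 ?dsum_norm_ge0// ler0c.
Qed.

Lemma norm_le_dsum_norm (H : preHilbertType R) n (h : 'I_n -> H) i :
  `|h i| <= dsum_norm h.
Proof.
rewrite -(ler_pXn2r (_ : 0 < 2)%N) ?nnegrE ?dsum_norm_ge0//.
by rewrite dsum_norm_sqr (bigD1 i)//= lerDl sumr_ge0.
Qed.

Lemma dsum_norm_le_sum (H : preHilbertType R) n (h : 'I_n -> H) :
  dsum_norm h <= \sum_i `|h i|.
Proof.
rewrite -(ler_pXn2r (_ : 0 < 2)%N) ?nnegrE ?dsum_norm_ge0 ?sumr_ge0//.
rewrite dsum_norm_sqr expr2 mulr_suml; apply: ler_sum => i _.
rewrite expr2 ler_wpM2l// (bigD1 i)//= lerDl sumr_ge0//.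
Qed.

Lemma bop_bound (H K : normedModType C) (T : bop H K) :
  exists2 M : R, 0 <= M & forall v, `|T v| <= M%:C * `|v|.
Proof.
have /asboolP[_ [M TM]] := bop_funP T.
exists (complex.Re `|M|); first by rewrite -ler0c RRe_real ?normr_real.
move=> v; rewrite RRe_real ?normr_real//.
rewrite -[`|v|]normr_id -normrM.
by rewrite ger0_norm ?TM// (le_trans _ (TM v)).
Qed.

Lemma mxop_bounded (H K : preHilbertType R) m n (T : 'M[bop H K]_(m, n)) :
  exists2 M : R, 0 <= M &
    forall h, dsum_norm (mxop_apply T h) <= M%:C * dsum_norm h.
Proof.
have /choice[M /all_and2[M0 hM]] (p : 'I_m * 'I_n) : exists M : R, 0 <= M /\
    forall v, `|T p.1 p.2 v| <= M%:C * `|v|.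
  by have [M] := bop_bound (T p.1 p.2); exists M.
exists (\sum_i \sum_j M (i, j)).
  by apply: sumr_ge0 => i _; apply: sumr_ge0.
move=> h; apply: le_trans (dsum_norm_le_sum _) _.
rewrite rmorph_sum mulr_suml; apply: ler_sum => i _.
apply: le_trans (ler_norm_sum _ _ _) _.
rewrite rmorph_sum mulr_suml; apply: ler_sum => k _.
apply: le_trans (hM (i, k) _) _; rewrite ler_wpM2l ?norm_le_dsum_norm//.
by rewrite ler0c.
Qed.

(** The infimum defining the norm is attained. *)
Lemma mxopnorm_bound (H K : preHilbertType R) m n (T : 'M[bop H K]_(m, n)) h :
  dsum_norm (mxop_apply T h) <= (mxopnorm T)%:C * dsum_norm h.
Proof.
pose S := [set t : R | 0 <= t /\
    forall h, dsum_norm (mxop_apply T h) <= t%:C * dsum_norm h].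
have hS : has_inf S.
  split; last by exists 0 => t [].
  by have [M M0 hM] := mxop_bounded T; exists M.
rewrite -subr_le0; apply: (@le_smallC _ _ (dsum_norm h)) => e e0.
have [t [t0 ht] te] := inf_adherent e0 hS.
rewrite lerBlDr -mulrDl -rmorphD/= addrC; apply: le_trans (ht h) _.
by rewrite ler_wpM2r ?dsum_norm_ge0// lecR ltW.
Qed.

Lemma mxopnorm_le (H K : preHilbertType R) m n (T : 'M[bop H K]_(m, n)) (r : R) :
  0 <= r -> (forall h, dsum_norm (mxop_apply T h) <= r%:C * dsum_norm h) ->
  mxopnorm T <= r.
Proof. by move=> r0 hr; apply: ge_inf; [exists 0 => t []|split]. Qed.

Lemma opnorm_le (H K : normedModType C) (T : bop H K) (x : C) : 0 <= x ->
  (forall v, `|T v| <= x * `|v|) -> (opnorm T)%:C ^+ 2 <= x ^+ 2.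
Proof.
move=> x0 hx; have xE : x = (complex.Re x)%:C by rewrite RRe_real// ger0_real.
have o0 : 0 <= opnorm T by apply: lb_le_inf; [|by move=> t []];
  have [M M0 hM] := bop_bound T; exists M.
rewrite ler_pXn2r ?nnegrE ?ler0c// xE lecR; apply: ge_inf; first by exists 0 => t [].
by split; [rewrite -ler0c -xE|move=> v; rewrite -xE].
Qed.

Variable B : cstarType R.

(** Nonnegativity of r covers the supremum of the empty set, which is 0. *)
Lemma cstar_mxnorm_le n (A : 'M[B]_n) (r : R) : 0 <= r ->
  (forall (K : hilbertType R) (pi : {linear B -> bop K K}) h,
    is_representation pi ->
    dsum_norm (mxop_apply (map_mx pi A) h) <= r%:C * dsum_norm h) ->
  cstar_mxnorm A <= r.
Proof.
move=> r0 hr; rewrite /cstar_mxnorm; set S := [set _ | _].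
have [S0|S0] := pselect (S !=set0).
  apply: ge_sup => // _ [K [pi [rpi ->]]].
  by apply: mxopnorm_le => // h; exact: hr.
rewrite (_ : S = set0) ?sup0//; apply/seteqP; split=> // x Sx.
by apply: S0; exists x.
Qed.

Lemma representation_cpos (K : hilbertType R) (pi : {linear B -> bop K K}) b h :
  is_representation pi -> cpos b -> 0 <= hdot (pi b h) h.
Proof.
move=> [_ piM piS] /cpos_sqrt[k [[sk _] <- _]].
rewrite -{1}sk piM /= piS starK hdot_norm exprn_ge0//.
Qed.

Lemma representation_column (K : hilbertType R) (pi : {linear B -> bop K K})
  (I : finType) (b : I -> B) (r : R) h : is_representation pi ->
  cpos (r%:C%:A - \sum_i star (b i) * b i) ->
  \sum_i `|pi (b i) h| ^+ 2 <= r%:C * `|h| ^+ 2.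
Proof.
move=> rpi /(representation_cpos h rpi); have [pi1 piM piS] := rpi.
pose g c := hdot (pi c h) h; have gl : scalar g.
  move=> t a c; rewrite /g linearP.
  by rewrite -[LHS]/(hdot (t *: pi a h + pi c h) h) linearPl.
pose g' : {scalar B} := HB.pack g (GRing.isLinear.Build _ _ _ _ g gl).
rewrite -[hdot _ _]/(g' _) linearB linearZ linear_sum /= subr_ge0.
have -> : g 1 = `|h| ^+ 2 by rewrite /g pi1 -hdot_norm.
apply: le_trans; rewrite le_eqVlt; apply/orP; left; apply/eqP.
apply: eq_bigr => i _; by rewrite /g piM /= piS starK hdot_norm.
Qed.

End MatrixNorms.

(** * Contractivity on rows and columns *)

Section ConjugateModule.
Variables (R : realType) (V : lmodType R[i]).

(** V with scalars acting through complex conjugation. *)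
Definition conj_mod : Type := V.
HB.instance Definition _ := GRing.Zmodule.on conj_mod.

Definition conj_scale (c : R[i]) (v : conj_mod) : conj_mod := (c^*)%R *: (v : V).

Fact conj_scalerA a b v : conj_scale a (conj_scale b v) = conj_scale (a * b) v.
Proof. by rewrite /conj_scale scalerA rmorphM. Qed.

Fact conj_scale1r : left_id 1 conj_scale.
Proof. by move=> v; rewrite /conj_scale rmorph1 scale1r. Qed.

Fact conj_scalerDr : right_distributive conj_scale +%R.
Proof. by move=> a u v; rewrite /conj_scale -scalerDr. Qed.

Fact conj_scalerDl v : {morph conj_scale^~ v : a b / a + b}.
Proof. by move=> a b; rewrite /conj_scale rmorphD scalerDl. Qed.

HB.instance Definition _ := GRing.Zmodule_isLmodule.Build R[i] conj_mod
  conj_scalerA conj_scale1r conj_scalerDr conj_scalerDl.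

End ConjugateModule.

Section RowsAndColumns.
Variables (R : realType) (H K : preHilbertType R) (V : zmodType).
Variables (f : V -> bop H K) (n : nat) (a : 'I_n.+1 -> V).
Hypothesis f0 : f 0 = 0.

Definition first_col : 'M[V]_n.+1 := \matrix_(i, k) if k == ord0 then a i else 0.
Definition first_row : 'M[V]_n.+1 := \matrix_(i, k) if i == ord0 then a k else 0.

Lemma first_col_apply h i :
  mxop_apply (map_mx f first_col) h i = f (a i) (h ord0).
Proof.
rewrite /mxop_apply (bigD1 ord0)//= !mxE eqxx big1 ?addr0// => k k0.
by rewrite !mxE (negPf k0) f0.
Qed.

Lemma first_row_apply h i :
  mxop_apply (map_mx f first_row) h i =
  if i == ord0 then \sum_k f (a k) (h k) else 0.
Proof.
rewrite /mxop_apply; case: ifPn => [/eqP ->|i0].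
  by apply: eq_bigr => k _; rewrite !mxE eqxx.
by rewrite big1// => k _; rewrite !mxE (negPf i0) f0.
Qed.

Lemma first_row_norm h :
  \sum_i `|mxop_apply (map_mx f first_row) h i| ^+ 2 =
  `|\sum_k f (a k) (h k)| ^+ 2.
Proof.
rewrite (bigD1 ord0)//= first_row_apply eqxx [X in _ + X]big1 ?addr0// => i i0.
by rewrite first_row_apply (negPf i0) normr0 expr0n.
Qed.

End RowsAndColumns.

(** One extra zero entry keeps the matrices below of positive size when s is empty. *)
Lemma big_nth_pad (V W : zmodType) (F : V -> W) (s : seq V) : F 0 = 0 ->
  \sum_(z <- s) F z = \sum_(i < (size s).+1) F (nth 0 s i).
Proof.
move=> F0; rewrite big_ord_recr /= nth_default// F0 addr0.
by rewrite (big_nth 0) big_mkord.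
Qed.

Section DirectSum.
Variable R : realType.
Local Notation C := R[i].

Lemma dsum_dot_semi_inner (H : preHilbertType R) n :
  semi_inner (@dsum_dot R H n).
Proof.
split=> [t u v w|t u v w|u].
- rewrite /dsum_dot mulr_sumr -big_split; apply: eq_bigr => i _.
  exact: semi_innerPl (hdot_semi_inner H) _ _ _ _.
- rewrite /dsum_dot mulr_sumr -big_split; apply: eq_bigr => i _.
  exact: semi_innerPr (hdot_semi_inner H) _ _ _ _.
- by apply: sumr_ge0 => i _; rewrite hdot_norm.
Qed.

Variable B : cstarType R.

(** With k = sum pi (b i) (h i), one has |k|^2 = sum <h i, pi (star (b i)) k>, and the
vectors pi (star (b i)) k form a column, to which [representation_column] and the
Cauchy-Schwarz inequality apply. *)
Lemma representation_row (K : hilbertType R) (pi : {linear B -> bop K K}) n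
  (b : 'I_n -> B) (r : R) (h : 'I_n -> K) : is_representation pi -> 0 <= r ->
  cpos (r%:C%:A - \sum_i b i * star (b i)) ->
  `|\sum_i pi (b i) (h i)| ^+ 2 <= r%:C * \sum_i `|h i| ^+ 2.
Proof.
move=> rpi r0 pb; have [_ _ piS] := rpi; set k := \sum_i _.
have [->|k0] := eqVneq k 0.
  by rewrite normr0 expr0n mulr_ge0 ?ler0c// sumr_ge0// => i _; rewrite exprn_ge0.
have kp : 0 < `|k| ^+ 2 by rewrite exprn_gt0// normr_gt0.
pose g i := pi (star (b i)) k.
have gk : \sum_i `|g i| ^+ 2 <= r%:C * `|k| ^+ 2.
  by apply: representation_column => //; under eq_bigr do rewrite starK.
have [+ _] := semi_inner_CS (dsum_dot_semi_inner K n) h g.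
have -> : dsum_dot h g = `|k| ^+ 2.
  rewrite -hdot_norm {1}/k hdot_suml; apply: eq_bigr => i _.
  by rewrite piS.
rewrite (ger0_norm (ltW kp)) => cs; rewrite -(ler_pM2r kp) -expr2.
apply: le_trans cs _; rewrite mulrAC.
have dE (u : 'I_n -> K) : dsum_dot u u = \sum_i `|u i| ^+ 2.
  by apply: eq_bigr => i _; rewrite hdot_norm.
rewrite !dE [leRHS]mulrC; apply: ler_wpM2l => //.
by apply: sumr_ge0 => i _; rewrite exprn_ge0.
Qed.

Variables (P : pred B) (X : @subLmodType C B P) (H K : preHilbertType R).
Variable psi : {linear X -> bop H K}.
Hypothesis psiC : completely_contractive psi.

Lemma completely_contractive_bound n (x : 'M[X]_n) (r : R) : 0 <= r ->
  (forall (L : hilbertType R) (pi : {linear B -> bop L L}) h,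
     is_representation pi ->
     \sum_i `|mxop_apply (map_mx (fun y => pi (val y)) x) h i| ^+ 2 <=
     r%:C * \sum_i `|h i| ^+ 2) ->
  forall h, \sum_i `|mxop_apply (map_mx psi x) h i| ^+ 2 <=
    r%:C * \sum_i `|h i| ^+ 2.
Proof.
move=> r0 hr h; pose t := Num.sqrt r; have t0 : 0 <= t by rewrite sqrtr_ge0.
have tt : r%:C = t%:C ^+ 2 by rewrite -rmorphXn /= sqr_sqrtr.
rewrite tt -dsum_norm_le//; apply: le_trans (mxopnorm_bound _ _) _.
rewrite ler_wpM2r ?dsum_norm_ge0// lecR.
apply: le_trans (psiC x) _; apply: cstar_mxnorm_le => // L pi k rpi.
by rewrite dsum_norm_le// -tt -map_mx_comp; exact: hr.
Qed.

Lemma column_bound (zs : seq X) (r : R) (h : H) : 0 <= r ->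
  cpos (r%:C%:A - \sum_(z <- zs) star (val z) * val z) ->
  \sum_(z <- zs) `|psi z h| ^+ 2 <= r%:C * `|h| ^+ 2.
Proof.
have v0 : val (0 : X) = 0 by rewrite raddf0.
move=> r0; rewrite (big_nth_pad (F := fun z : X => star (val z) * val z)).
  2: by rewrite v0 mulr0.
rewrite (big_nth_pad (F := fun z : X => `|psi z h| ^+ 2)); last first.
  by rewrite linear0 normr0 expr0n.
set a := fun i : 'I_(size zs).+1 => nth 0 zs i => pa.
have := @completely_contractive_bound _ (first_col a) r r0.
move=> /(_ _ (fun i => if i == ord0 then h else 0)).
under eq_bigr do rewrite first_col_apply ?linear0// eqxx.
have -> : \sum_(i < (size zs).+1) `|if i == ord0 then h else 0| ^+ 2 =
    `|h| ^+ 2.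
  rewrite (bigD1 ord0)//= big1 ?addr0// => i i0.
  by rewrite (negPf i0) normr0 expr0n.
apply=> L pi k rpi.
under eq_bigr do rewrite first_col_apply ?v0 ?linear0//.
apply: le_trans (representation_column (k ord0) rpi pa) _.
by rewrite ler_wpM2l ?ler0c// (bigD1 ord0)//= lerDl sumr_ge0.
Qed.

Lemma row_bound n (a : 'I_n.+1 -> X) (r : R) (h : 'I_n.+1 -> H) : 0 <= r ->
  cpos (r%:C%:A - \sum_i val (a i) * star (val (a i))) ->
  `|\sum_i psi (a i) (h i)| ^+ 2 <= r%:C * \sum_i `|h i| ^+ 2.
Proof.
have v0 : val (0 : X) = 0 by rewrite raddf0.
move=> r0 pa; rewrite -first_row_norm ?linear0//.
apply: completely_contractive_bound => // L pi k rpi.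
rewrite first_row_norm ?v0 ?linear0//.
exact: representation_row rpi r0 pa.
Qed.

End DirectSum.

(** * The row and column cases *)

Section MainTheorem.
Variables (R : realType) (B : cstarType R) (P : pred B).
Variables (X : @subLmodType R[i] B P) (H : hilbertType R).
Local Notation C := R[i].

Lemma bop_leP (S T : bop H H) :
  (forall h, hdot (S h) h <= hdot (T h) h) -> op_le S T.
Proof.
move=> h v; rewrite -[X in hdot X v]/(T v - S v) linearBl /= subr_ge0; exact: h.
Qed.

Section Column.
Variable psi : {linear X -> bop C^o H}.
Hypothesis psiC : completely_contractive psi.

Definition column_vector (x : X) : H := psi x 1.

Lemma column_vector_linear : linear column_vector.
Proof. by move=> t x y; rewrite /column_vector linearP. Qed.

HB.instance Definition _ := GRing.isLinear.Build C X H _ column_vector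
  column_vector_linear.

Lemma column_psi x c : psi x c = c *: column_vector x.
Proof. by rewrite /column_vector -bopZ [_ *: _](mulr1 c). Qed.

Lemma column_vector_contractive :
  column_contractive (\val : {linear X -> B}) column_vector.
Proof.
move=> zs r r0 pr; have := column_bound psiC (1 : C^o) r0 pr.
by rewrite normr1 expr1n mulr1.
Qed.

Lemma column_case : exists (s : {scalar B}) (Phi : {linear B -> bop H H}),
  [/\ is_state s, is_ucp Phi &
    forall x : X,
      (opnorm (psi x))%:C ^+ 2 <= s (star (val x) * val x) /\
      op_le (bop_comp (psi x) (adj (psi x))) (Phi (val x * star (val x)))].
Proof.
have [s [sP sxi]] := dominating_state column_vector_contractive.
have [Phi [PhiP Phixi]] := dominating_ucp sP sxi.
exists s, Phi; split=> // x; split.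
  apply: le_trans (sxi x); apply: opnorm_le => // c.
  by rewrite column_psi normrZ mulrC.
apply: bop_leP => h; apply: le_trans (Phixi x h).
have adjx := adjP (adj_exists_line (psi x)).
rewrite /= adjx hdot_norm.
have -> : adj (psi x) h = ((hdot (column_vector x) h)^*)%R.
  have lineE (c w : C^o) : hdot c w = c * (w^*)%R by [].
  by rewrite /column_vector adjx lineE mul1r conjCK.
by rewrite norm_conjC.
Qed.

End Column.

Section Row.
Variable psi : {linear X -> bop H C^o}.
Hypothesis psiC : completely_contractive psi.

Definition row_vector (x : conj_mod X) : H := adj (psi x) 1.
Definition row_embedding (x : conj_mod X) : B := star (val (x : X)).

Lemma row_psi (x : X) h : psi x h = hdot h (row_vector x).
Proof.
rewrite -(adjP (adj_exists (psi x))) -[RHS]/(psi x h * (1^*)%R).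
by rewrite rmorph1 mulr1.
Qed.

Lemma row_vector_linear : linear row_vector.
Proof.
move=> t x y; apply: hdot_inj => h; rewrite linearPl /= -[RHS]conjCK.
rewrite rmorphD rmorphM /= -!hdotC -!row_psi hdotC -row_psi.
by congr (_^*)%R; rewrite -[t *: x]/((t^*)%R *: (x : X)) linearP.
Qed.

HB.instance Definition _ := GRing.isLinear.Build C (conj_mod X) H _ row_vector
  row_vector_linear.

Lemma row_embedding_linear : linear row_embedding.
Proof.
move=> t x y; rewrite /row_embedding -[t *: x]/((t^*)%R *: (x : X)).
by rewrite raddfD/= linearZ/= raddfD/= starZ conjCK.
Qed.

HB.instance Definition _ := GRing.isLinear.Build C (conj_mod X) B _
  row_embedding row_embedding_linear.

(** The row with entries psi z is evaluated on the vectors row_vector z themselves,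
which gives S ^ 2 <= r * S for the sum S of their squared norms. *)
Lemma row_vector_contractive : column_contractive row_embedding row_vector.
Proof.
move=> zs r r0 pr; set S := \sum_(z <- zs) _.
pose a (i : 'I_(size zs).+1) : X := nth 0 zs i.
have SE : S = \sum_i `|row_vector (a i)| ^+ 2.
  rewrite /S (big_nth_pad (F := fun z => `|row_vector z| ^+ 2))//.
  by rewrite linear0 normr0 expr0n.
have pa : cpos (r%:C%:A - \sum_i val (a i) * star (val (a i))).
  move: pr.
  rewrite (big_nth_pad (F := fun z => star (row_embedding z) * row_embedding z)).
    by under eq_bigr do rewrite /row_embedding starK.
  by rewrite linear0 mulr0.
have := row_bound psiC (fun i => row_vector (a i)) r0 pa.
under eq_bigr do rewrite row_psi hdot_norm.
rewrite -SE; have S0 : 0 <= S by rewrite SE sumr_ge0.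
rewrite (ger0_norm S0) expr2; have [-> _|Sn0] := eqVneq S 0.
  by rewrite ler0c.
by rewrite ler_pM2r// lt_def Sn0.
Qed.

Lemma row_case : exists (s : {scalar B}) (Phi : {linear B -> bop H H}),
  [/\ is_state s, is_ucp Phi &
    forall x : X,
      (opnorm (psi x))%:C ^+ 2 <= s (val x * star (val x)) /\
      op_le (bop_comp (adj (psi x)) (psi x)) (Phi (star (val x) * val x))].
Proof.
have [s [sP sxi]] := dominating_state row_vector_contractive.
have [Phi [PhiP Phixi]] := dominating_ucp sP sxi.
exists s, Phi; split=> // x; split.
  have := sxi x; rewrite /= /row_embedding starK; apply: le_trans.
  apply: opnorm_le => // h; rewrite row_psi mulrC; exact: hdot_CS.
apply: bop_leP => h; have := Phixi x h; rewrite /= /row_embedding starK.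
apply: le_trans; rewrite hdotC -(adjP (adj_exists (psi x))) hdot_norm.
rewrite row_psi hdotC norm_conjC conj_Creal ?rpredX ?normr_real//.
Qed.

End Row.

End MainTheorem.

Theorem theorem3p2 (R : realType) (B : cstarType R)
    (P : pred B) (X : @subLmodType R[i] B P) (H : hilbertType R) :
  (forall psi : {linear X -> bop H R[i]^o},
     completely_contractive psi ->
     exists (s : {scalar B}) (Phi : {linear B -> bop H H}),
       [/\ is_state s, is_ucp Phi &
         forall x : X,
           (opnorm (psi x))%:C ^+ 2 <= s (val x * star (val x)) /\
           op_le (bop_comp (adj (psi x)) (psi x))
                 (Phi (star (val x) * val x))]) /\
  (forall psi : {linear X -> bop R[i]^o H},
     completely_contractive psi ->
     exists (s : {scalar B}) (Phi : {linear B -> bop H H}),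
       [/\ is_state s, is_ucp Phi &
         forall x : X,
           (opnorm (psi x))%:C ^+ 2 <= s (star (val x) * val x) /\
           op_le (bop_comp (psi x) (adj (psi x)))
                 (Phi (val x * star (val x)))]).
Proof.
split=> psi psiC; [exact: row_case|exact: column_case].
Qed.
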